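(* Let $\mathcal{A}$ be an abelian category with subcategories $\mathcal{W}\subseteq\mathcal{X}$ and $\mathcal{V}\subseteq\mathcal{Y}$ such that $\mathcal{W}$ is a cogenerator for $\mathcal{X}$ and $\mathcal{V}$ is a generator for $\mathcal{Y}$. Let $M$ and $N$ be objects in $\mathcal{A}$. (a) Assume $(\mathcal{X}\cup\mathcal{V})\perp\mathcal{V}$ and $\operatorname{Ext}^{\geq1}_{\mathcal{A}\mathcal{V}}(\mathcal{W},\operatorname{cores}\widehat{\mathcal{V}})=0$. If $M$ is in $\operatorname{res}\widetilde{\mathcal{X}}\cap\operatorname{res}\widetilde{\mathcal{W}}$ and $N$ is in $\operatorname{cores}\widehat{\mathcal{V}}$, then the map $\vartheta^n_{\mathcal{X}\mathcal{W}\mathcal{A}}(M,N)\colon\operatorname{Ext}^n_{\mathcal{X}\mathcal{A}}(M,N)\to\operatorname{Ext}^n_{\mathcal{W}\mathcal{A}}(M,N)$ is an isomorphism for each $n$. (b) Assume $\mathcal{W}\perp(\mathcal{W}\cup\mathcal{Y})$ and $\operatorname{Ext}^{\geq1}_{\mathcal{W}\mathcal{A}}(\operatorname{res}\widehat{\mathcal{W}},\mathcal{V})=0$. If $M$ is in $\operatorname{res}\widehat{\mathcal{W}}$ and $N$ is in $\operatorname{cores}\widetilde{\mathcal{Y}}\cap\operatorname{cores}\widetilde{\mathcal{V}}$, then the map $\vartheta^n_{\mathcal{A}\mathcal{Y}\mathcal{V}}(M,N)\colon\operatorname{Ext}^n_{\mathcal{A}\mathcal{Y}}(M,N)\to\operatorname{Ext}^n_{\mathcal{A}\mathcal{V}}(M,N)$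 is an isomorphism for each $n$.
   Context: ''Subcategory'' means full, additive subcategory closed under isomorphisms. For classes $\mathcal{C},\mathcal{D}$ of objects, $\mathcal{C}\perp\mathcal{D}$ means $\operatorname{Ext}^i_{\mathcal{A}}(C,D)=0$ for all $i\geq1$, $C\in\mathcal{C}$, $D\in\mathcal{D}$. $\mathcal{W}$ is a cogenerator for $\mathcal{X}$ if for each $X\in\mathcal{X}$ there is an exact sequence $0\to X\to W\to X'\to0$ with $W\in\mathcal{W}$, $X'\in\mathcal{X}$. $\mathcal{V}$ is a generator for $\mathcal{Y}$ if for each $Y\in\mathcal{Y}$ there is an exact sequence $0\to Y'\to V\to Y\to 0$ with $V\in\mathcal{V}$, $Y'\in\mathcal{Y}$. Complexes are indexed homologically. For a subcategory $\mathcal{C}$, a $\mathcal{C}$-resolution of $M$ is a complex $C$ of objects of $\mathcal{C}$ with $C_n=0$ for $n<0$, $\operatorname{H}_n(C)=0$ for $n>0$ and $\operatorname{H}_0(C)\cong M$; its augmented resolution is $C^+=\cdots\to C_1\to C_0\to M\to0$. It is proper if $\operatorname{Hom}_{\mathcal{A}}(C',C^+)$ is exact for every $C'\in\mathcal{C}$. $\operatorname{res}\widehat{\mathcal{C}}$ (resp. $\operatorname{res}\widetilde{\mathcal{C}}$) is the subcategory of objects having a bounded (resp. proper) $\mathcal{C}$-resolution. Dually, a $\mathcal{C}$-coresolution of $N$ is a complex $C$ of objects of $\mathcal{C}$ with $C_n=0$ for $n>0$, $\operatorname{H}_n(C)=0$ for $n<0$ and $\operatorname{H}_0(C)\cong N$,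 with augmented coresolution ${}^+C=0\to N\to C_0\to C_{-1}\to\cdots$; it is proper if $\operatorname{Hom}_{\mathcal{A}}({}^+C,C')$ is exact for every $C'\in\mathcal{C}$. $\operatorname{cores}\widehat{\mathcal{C}}$ (resp. $\operatorname{cores}\widetilde{\mathcal{C}}$) is the subcategory of objects having a bounded (resp. proper) $\mathcal{C}$-coresolution. If $M$ has a proper $\mathcal{C}$-resolution $C\to M$, then $\operatorname{Ext}^n_{\mathcal{C}\mathcal{A}}(M,N)=\operatorname{H}_{-n}(\operatorname{Hom}_{\mathcal{A}}(C,N))$. If $N$ has a proper $\mathcal{C}$-coresolution $N\to C$, then $\operatorname{Ext}^n_{\mathcal{A}\mathcal{C}}(M,N)=\operatorname{H}_{-n}(\operatorname{Hom}_{\mathcal{A}}(M,C))$. These are independent of choices. (If $\mathcal{W}\perp\mathcal{W}$, bounded $\mathcal{W}$-resolutions are proper; if $\mathcal{V}\perp\mathcal{V}$, bounded $\mathcal{V}$-coresolutions are proper.) $\operatorname{Ext}^{\geq1}_{\mathcal{A}\mathcal{V}}(\mathcal{W},\operatorname{cores}\widehat{\mathcal{V}})=0$ means $\operatorname{Ext}^{n}_{\mathcal{A}\mathcal{V}}(W,U)=0$ for all $n\ge1$, $W\in\mathcal{W}$, $U\in\operatorname{cores}\widehat{\mathcal{V}}$; similarly in (b). Comparison maps: if $M$ has a proper $\mathcal{W}$-resolution $\gamma\colon W\to M$ and a proper $\mathcal{X}$-resolution $\gamma'\colon X\to M$, there is a morphism $\overline{\operatorname{id}_M}\colon W\to X$,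 unique up to homotopy (and a quasiisomorphism), with $\gamma=\gamma'\,\overline{\operatorname{id}_M}$; then $\vartheta^n_{\mathcal{X}\mathcal{W}\mathcal{A}}(M,N)=\operatorname{H}_{-n}(\operatorname{Hom}_{\mathcal{A}}(\overline{\operatorname{id}_M},N))$. If $N$ has a proper $\mathcal{Y}$-coresolution $\delta\colon N\to Y$ and a proper $\mathcal{V}$-coresolution $\delta'\colon N\to V$, there is a morphism $\overline{\operatorname{id}_N}\colon Y\to V$, unique up to homotopy (and a quasiisomorphism), with $\delta'=\overline{\operatorname{id}_N}\,\delta$; then $\vartheta^n_{\mathcal{A}\mathcal{Y}\mathcal{V}}(M,N)=\operatorname{H}_{-n}(\operatorname{Hom}_{\mathcal{A}}(M,\overline{\operatorname{id}_N}))$. *)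

(* Defs.v *)
From HB Require Import structures.
From Stdlib Require Import Relations.
From mathcomp Require Import all_boot all_order all_algebra.
From mathcomp Require Import all_classical.

Set Implicit Arguments.
Unset Strict Implicit.
Unset Printing Implicit Defensive.

Import Order.TTheory GRing.Theory Num.Theory.
Local Open Scope classical_set_scope.
Local Open Scope ring_scope.

(* Hom-sets are abelian groups in the sense of [zmodType]; the choice operator
   this carries exists on every type under the axioms of [boolp], so it does
   not restrict the categories considered. *)
Record preadditive := Preadditive {
  obj :> Type;
  hom : obj -> obj -> zmodType;
  idm : forall X, hom X X;
  comp : forall X Y Z, hom Y Z -> hom X Y -> hom X Z;
  compA : forall X Y Z T (h : hom Z T) (g : hom Y Z) (f : hom X Y),
    comp h (comp g f) = comp (comp h g) f;
  comp1m : forall X Y (f : hom X Y), comp (idm Y) f = f;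
  compm1 : forall X Y (f : hom X Y), comp f (idm X) = f;
  compDl : forall X Y Z (g g' : hom Y Z) (f : hom X Y),
    comp (g + g') f = comp g f + comp g' f;
  compDr : forall X Y Z (g : hom Y Z) (f f' : hom X Y),
    comp g (f + f') = comp g f + comp g f' }.

Arguments hom {p} X Y : rename.
Arguments idm {p} X : rename.
Arguments comp {p X Y Z} g f : rename.

Notation "g \c f" := (comp g f) (at level 40, left associativity).

Section Preadditive.
Variable A : preadditive.
Implicit Types X Y Z K Q T H : A.

Definition mono X Y (f : hom X Y) :=
  forall T (u v : hom T X), f \c u = f \c v -> u = v.

Definition epi X Y (f : hom X Y) :=
  forall T (u v : hom Y T), u \c f = v \c f -> u = v.

Definition is_kernel X Y (f : hom X Y) K (k : hom K X) :=
  f \c k = 0 /\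
  forall T (t : hom T X), f \c t = 0 -> exists! u : hom T K, k \c u = t.

Definition is_cokernel X Y (f : hom X Y) Q (q : hom Y Q) :=
  q \c f = 0 /\
  forall T (t : hom Y T), t \c f = 0 -> exists! u : hom Q T, u \c q = t.

Definition is_zero Z :=
  forall T, (forall f : hom T Z, f = 0) /\ (forall f : hom Z T, f = 0).

Definition is_biproduct X Y B :=
  exists (i : hom X B) (j : hom Y B) (p : hom B X) (q : hom B Y),
    [/\ p \c i = idm X, q \c j = idm Y, p \c j = 0, q \c i = 0
      & i \c p + j \c q = idm B].

Definition is_iso X Y (f : hom X Y) :=
  exists g : hom Y X, g \c f = idm X /\ f \c g = idm Y.

Definition iso X Y := exists f : hom X Y, is_iso f.

(* [H] is the homology of [X --f--> Y --g--> Z] at [Y]: the cokernel of the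
   map from [X] to the kernel of [g] induced by [f]. *)
Definition is_homology X Y Z (f : hom X Y) (g : hom Y Z) H :=
  exists K (k : hom K Y) (f' : hom X K) (p : hom K H),
    [/\ is_kernel g k, k \c f' = f & is_cokernel f' p].

Definition short_exact X Y Z (f : hom X Y) (g : hom Y Z) :=
  is_kernel g f /\ is_cokernel f g.

End Preadditive.

Record abelian := Abelian {
  acat :> preadditive;
  ab_zero : exists Z : acat, is_zero Z;
  ab_biproduct : forall X Y : acat, exists B, is_biproduct X Y B;
  ab_kernel : forall (X Y : acat) (f : hom X Y),
    exists K (k : hom K X), is_kernel f k;
  ab_cokernel : forall (X Y : acat) (f : hom X Y),
    exists Q (q : hom Y Q), is_cokernel f q;
  ab_mono : forall (X Y : acat) (f : hom X Y), mono f ->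
    exists Z (g : hom Y Z), is_kernel g f;
  ab_epi : forall (X Y : acat) (f : hom X Y), epi f ->
    exists Z (g : hom Z X), is_cokernel g f }.

(* As for complexes in [A] below, differentials are given between any two
   degrees and vanish unless they lower the degree by one; no transport along
   equalities of degrees is then ever needed. *)
Record abcomplex := AbComplex {
  abobj :> int -> zmodType;
  abd : forall i j, {additive abobj i -> abobj j};
  abd_shape : forall i j, i != j + 1 -> forall x, abd i j x = 0;
  abdd : forall i j k x, abd j k (abd i j x) = 0 }.

Arguments abd : clear implicits.

Record abmap (K L : abcomplex) := AbMap {
  abmap_fun :> forall i, {additive K i -> L i};
  abmapP : forall i j x, abmap_fun j (abd K i j x) = abd L i j (abmap_fun i x) }.

Section Homology.
Variables (K : abcomplex) (n : int).

Definition cycle_pred : {pred K n} := fun z => abd K n (n - 1) z == 0.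

Fact cycle_pred_closed : zmod_closed cycle_pred.
Proof.
split=> [|x y]; rewrite !unfold_in ?raddf0 // => /eqP x0 /eqP y0.
by rewrite raddfB /= x0 y0 subrr.
Qed.
HB.instance Definition _ :=
  GRing.isZmodClosed.Build (K n) cycle_pred cycle_pred_closed.

Record cycle := Cycle { cycle_val : K n; cycle_valP : cycle_val \in cycle_pred }.
HB.instance Definition _ := [isSub for cycle_val].
HB.instance Definition _ := [Choice of cycle by <:].
HB.instance Definition _ := [SubChoice_isSubZmodule of cycle by <:].

Definition boundary_pred : {pred cycle} :=
  fun z => `[< exists y, abd K (n + 1) n y = val z >].

Fact boundary_pred_closed : zmod_closed boundary_pred.
Proof.
split=> [|x y]; rewrite !unfold_in; first by apply/asboolP; exists 0; rewrite raddf0.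
move=> /asboolP[x' Ex] /asboolP[y' Ey]; apply/asboolP; exists (x' - y').
by rewrite !raddfB /= Ex Ey.
Qed.
HB.instance Definition _ :=
  GRing.isZmodClosed.Build cycle boundary_pred boundary_pred_closed.

Definition homology := @Quotient.quot cycle boundary_pred.
HB.instance Definition _ := GRing.Zmodule.on homology.

End Homology.

Definition homology_zero (K : abcomplex) n := forall x : homology K n, x = 0.

Definition ab_exact (K : abcomplex) := forall n, homology_zero K n.

Section HomologyMap.
Variables (K L : abcomplex) (f : abmap K L) (n : int).

Fact cycle_map_subproof (z : cycle K n) : f n (val z) \in @cycle_pred L n.
Proof. by rewrite unfold_in -abmapP (eqP (cycle_valP z)) raddf0. Qed.

Definition cycle_map (z : cycle K n) : cycle L n :=
  Cycle (cycle_map_subproof z).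

Definition homology_map (x : homology K n) : homology L n :=
  \pi_(homology L n)%qT (cycle_map (repr x)).

Fact homology_map_pi z :
  homology_map (\pi_(homology K n)%qT z) = \pi_(homology L n)%qT (cycle_map z).
Proof.
apply/eqP; rewrite -Quotient.idealrBE.
have: repr (\pi_(homology K n)%qT z) - z \in @boundary_pred K n.
  by rewrite Quotient.idealrBE reprK.
rewrite !unfold_in => /asboolP[y Ey]; apply/asboolP; exists (f (n + 1) y).
by rewrite -abmapP Ey !raddfB.
Qed.

Fact homology_map_additive : zmod_morphism homology_map.
Proof.
move=> x y; rewrite -[x]reprK -[y]reprK -raddfB !homology_map_pi -raddfB.
by congr \pi%qT; apply/val_inj; rewrite /= raddfB.
Qed.
HB.instance Definition _ :=
  GRing.isZmodMorphism.Build (homology K n) (homology L n) homology_map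
    homology_map_additive.

End HomologyMap.

Section Complexes.
Variable A : abelian.
Implicit Types M N U T : A.

Record complex := Complex {
  cobj :> int -> A;
  cd : forall i j, hom (cobj i) (cobj j);
  cd_shape : forall i j, i != j + 1 -> cd i j = 0;
  cdd : forall i j k, cd j k \c cd i j = 0 }.

Record cmap (C D : complex) := CMap {
  cmap_fun :> forall i, hom (C i) (D i);
  cmapP : forall i j, cmap_fun j \c cd C i j = cd D i j \c cmap_fun i }.

Definition exact_at (C : complex) n :=
  exists H, is_zero H /\ is_homology (cd C (n + 1) n) (cd C n (n - 1)) H.

Fact comp0m (X Y Z : A) (f : hom X Y) : (0 : hom Y Z) \c f = 0.
Proof. by apply/(addrI (0 \c f)); rewrite -compDl !addr0. Qed.

Fact compm0 (X Y Z : A) (f : hom Y Z) : f \c (0 : hom X Y) = 0.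
Proof. by apply/(addrI (f \c 0)); rewrite -compDr !addr0. Qed.

Definition postcomp (T X Y : A) (f : hom X Y) (u : hom T X) : hom T Y := f \c u.
Definition precomp (T X Y : A) (f : hom X Y) (u : hom Y T) : hom X T := u \c f.

Fact postcomp_additive T (X Y : A) (f : hom X Y) :
  zmod_morphism (@postcomp T X Y f).
Proof.
by move=> u v; apply/(addIr (f \c v)); rewrite /postcomp -compDr !subrK.
Qed.
HB.instance Definition _ T (X Y : A) (f : hom X Y) :=
  GRing.isZmodMorphism.Build (hom T X) (hom T Y) (@postcomp T X Y f)
    (@postcomp_additive T X Y f).

Fact precomp_additive T (X Y : A) (f : hom X Y) :
  zmod_morphism (@precomp T X Y f).
Proof.
by move=> u v; apply/(addIr (v \c f)); rewrite /precomp -compDl !subrK.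
Qed.
HB.instance Definition _ T (X Y : A) (f : hom X Y) :=
  GRing.isZmodMorphism.Build (hom Y T) (hom X T) (@precomp T X Y f)
    (@precomp_additive T X Y f).

Section HomFrom.
Variable M : A.

Fact homr_shape (C : complex) i j : i != j + 1 ->
  forall u : hom M (C i), postcomp (cd C i j) u = 0.
Proof. by move=> ij u; rewrite /postcomp cd_shape ?comp0m. Qed.

Fact homr_dd (C : complex) i j k (u : hom M (C i)) :
  postcomp (cd C j k) (postcomp (cd C i j) u) = 0.
Proof. by rewrite /postcomp compA cdd comp0m. Qed.

Definition homr (C : complex) : abcomplex :=
  @AbComplex (fun i => hom M (C i)) (fun i j => postcomp (cd C i j))
    (@homr_shape C) (@homr_dd C).

Fact homr_mapP (C D : complex) (f : cmap C D) i j (u : hom M (C i)) :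
  postcomp (f j) (postcomp (cd C i j) u) = postcomp (cd D i j) (postcomp (f i) u).
Proof. by rewrite /postcomp !compA cmapP. Qed.

Definition homr_map (C D : complex) (f : cmap C D) : abmap (homr C) (homr D) :=
  @AbMap (homr C) (homr D) (fun i => postcomp (f i)) (@homr_mapP C D f).

End HomFrom.

Section HomTo.
Variable N : A.

Fact homl_shape (C : complex) i j : i != j + 1 ->
  forall u : hom (C (- i)) N, precomp (cd C (- j) (- i)) u = 0.
Proof.
move=> ij u; rewrite /precomp cd_shape ?compm0 //; apply: contraNneq ij => ji.
by rewrite -[j]opprK ji opprD opprK subrK.
Qed.

Fact homl_dd (C : complex) i j k (u : hom (C (- i)) N) :
  precomp (cd C (- k) (- j)) (precomp (cd C (- j) (- i)) u) = 0.
Proof. by rewrite /precomp -compA cdd compm0. Qed.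

(* Hom(C, N), whose component of degree [i] is Hom(C_{-i}, N). The customary
   signs in the differential are omitted: they change neither cycles nor
   boundaries. *)
Definition homl (C : complex) : abcomplex :=
  @AbComplex (fun i => hom (C (- i)) N) (fun i j => precomp (cd C (- j) (- i)))
    (@homl_shape C) (@homl_dd C).

Fact homl_mapP (C D : complex) (f : cmap C D) i j (u : hom (D (- i)) N) :
  precomp (f (- j)) (precomp (cd D (- j) (- i)) u) =
  precomp (cd C (- j) (- i)) (precomp (f (- i)) u).
Proof. by rewrite /precomp -!compA cmapP. Qed.

Definition homl_map (C D : complex) (f : cmap C D) : abmap (homl D) (homl C) :=
  @AbMap (homl D) (homl C) (fun i => precomp (f (- i))) (@homl_mapP C D f).

End HomTo.

(* An [n]-fold extension 0 -> D -> E_n -> ... -> E_1 -> C -> 0, as an exact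
   complex concentrated in degrees 0, ..., n + 1 together with identifications
   of its two end terms with [C] and [D]. *)
Record extension (n : nat) (C D : A) := Extension {
  ext_cx :> complex;
  ext_supp : forall i : int, i < 0 \/ n.+1%:Z < i -> is_zero (ext_cx i);
  ext_exact : forall i, exact_at ext_cx i;
  ext_top : hom (ext_cx 0) C;
  ext_top_iso : is_iso ext_top;
  ext_bot : hom D (ext_cx n.+1%:Z);
  ext_bot_iso : is_iso ext_bot }.

Definition ext_step n C D (E F : extension n C D) :=
  exists f : cmap E F,
    ext_top F \c f 0 = ext_top E /\ f n.+1%:Z \c ext_bot E = ext_bot F.

Definition ext_equiv n C D := clos_refl_sym_trans _ (@ext_step n C D).

(* For [n >= 1]. No enough-projectives assumption is made, so that
   Ext^n(C, D) is the group of Yoneda classes of [n]-fold extensions; it is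
   trivial when there is only one class. *)
Definition Ext_zero n (C D : A) := forall E F : extension n C D, ext_equiv E F.

Definition perp (C D : set A) :=
  forall i X Y, (1 <= i)%N -> C X -> D Y -> Ext_zero i X Y.

(* A full subcategory is given by its set of objects. *)
Definition subcategory (C : set A) :=
  [/\ forall Z : A, is_zero Z -> C Z,
      forall X Y B : A, C X -> C Y -> is_biproduct X Y B -> C B
    & forall X Y : A, iso X Y -> C X -> C Y].

Definition cogenerator (W X : set A) :=
  forall M : A, X M -> exists W0 M' (f : hom M W0) (g : hom W0 M'),
    [/\ W W0, X M' & short_exact f g].

Definition generator (V Y : set A) :=
  forall M : A, Y M -> exists V0 M' (f : hom M' V0) (g : hom V0 M),
    [/\ V V0, Y M' & short_exact f g].

(* As [C_{-1} = 0], H_0(C) is the cokernel of [C_1 -> C_0]; [res_coker] thus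
   says that [res_aug] induces an isomorphism from H_0(C) to [M]. *)
Record resolution (C : set A) (M : A) := Resolution {
  res_cx :> complex;
  res_aug : hom (res_cx 0) M;
  res_mem : forall i, C (res_cx i);
  res_neg : forall i, i < 0 -> is_zero (res_cx i);
  res_exact : forall i, 0 < i -> exact_at res_cx i;
  res_coker : is_cokernel (cd res_cx 1 0) res_aug }.

Record coresolution (C : set A) (N : A) := Coresolution {
  cores_cx :> complex;
  cores_aug : hom N (cores_cx 0);
  cores_mem : forall i, C (cores_cx i);
  cores_pos : forall i, 0 < i -> is_zero (cores_cx i);
  cores_exact : forall i, i < 0 -> exact_at cores_cx i;
  cores_ker : is_kernel (cd cores_cx 0 (-1)) cores_aug }.

Section Augmented.
Variables (C : set A) (M : A) (P : resolution C M).

(* The pattern [Negz 0] is the integer -1. *)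
Definition aug_obj (i : int) : A := if i is Negz 0 then M else P i.

Definition aug_d (i j : int) : hom (aug_obj i) (aug_obj j) :=
  match i, j with
  | Posz 0, Negz 0 => res_aug P
  | Posz m, Posz n => cd P m n
  | _, _ => 0
  end.

Fact aug_shape i j : i != j + 1 -> aug_d i j = 0.
Proof.
case: i j => [[|m]|[|m]] [[|n]|[|n]] //=; by move=> ij; rewrite ?cd_shape.
Qed.

Fact aug_dd i j k : aug_d j k \c aug_d i j = 0.
Proof.
case: i j k => [[|m]|[|m]] [[|n]|[|n]] [[|p]|[|p]] /=;
  rewrite ?comp0m ?compm0 ?cdd //; last case: m => [|m];
  by [apply: (res_coker P).1 | rewrite cd_shape ?compm0].
Qed.

Definition augmented := Complex aug_shape aug_dd.

End Augmented.

Section Coaugmented.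
Variables (C : set A) (N : A) (P : coresolution C N).

Definition coaug_obj (i : int) : A := if i is Posz 1 then N else P i.

Definition coaug_d (i j : int) : hom (coaug_obj i) (coaug_obj j) :=
  match i, j with
  | Posz 1, Posz 0 => cores_aug P
  | Posz 0, Negz n => cd P 0 (Negz n)
  | Negz m, Negz n => cd P (Negz m) (Negz n)
  | _, _ => 0
  end.

Fact coaug_shape i j : i != j + 1 -> coaug_d i j = 0.
Proof.
case: i j => [[|[|m]]|m] [[|[|n]]|n] //=; by [apply: cd_shape].
Qed.

Fact coaug_dd i j k : coaug_d j k \c coaug_d i j = 0.
Proof.
case: i j k => [[|[|m]]|m] [[|[|n]]|n] [[|[|p]]|p] /=;
  rewrite ?comp0m ?compm0 ?cdd //; case: p => [|p];
  by [apply: (cores_ker P).1 | rewrite cd_shape ?comp0m].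
Qed.

Definition coaugmented := Complex coaug_shape coaug_dd.

End Coaugmented.

Definition proper_res C M (P : resolution C M) :=
  forall C', C C' -> ab_exact (homr C' (augmented P)).

Definition proper_cores C N (P : coresolution C N) :=
  forall C', C C' -> ab_exact (homl C' (coaugmented P)).

Definition bounded (C : complex) :=
  exists b : int, forall i, b < `|i| -> is_zero (C i).

Definition res_hat (C : set A) : set A :=
  [set M | exists P : resolution C M, bounded P].

Definition res_tilde (C : set A) : set A :=
  [set M | exists P : resolution C M, proper_res P].

Definition cores_hat (C : set A) : set A :=
  [set N | exists P : coresolution C N, bounded P].

Definition cores_tilde (C : set A) : set A :=
  [set N | exists P : coresolution C N, proper_cores P].

(* Relative Ext groups computed from a given (co)resolution, which is meant to
   be proper; up to canonical isomorphism they do not depend on it. *)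
Definition relExt_l C M (P : resolution C M) (N : A) (n : int)
  : zmodType := homology (homl N P) (- n).

Definition relExt_r C N (M : A) (P : coresolution C N) (n : int)
  : zmodType := homology (homr M P) (- n).

(* Well posed because all proper (co)resolutions give the same groups. *)
Definition relExt_l_zero (C : set A) M N (n : int) :=
  forall P : resolution C M, proper_res P -> forall x : relExt_l P N n, x = 0.

Definition relExt_r_zero (C : set A) M N (n : int) :=
  forall P : coresolution C N, proper_cores P ->
  forall x : relExt_r M P n, x = 0.

Definition lifts_id_res (W X : set A) M (P : resolution W M)
    (Q : resolution X M) (f : cmap P Q) :=
  res_aug Q \c f 0 = res_aug P.

Definition lifts_id_cores (Y V : set A) N (P : coresolution Y N)
    (Q : coresolution V N) (f : cmap P Q) :=
  f 0 \c cores_aug P = cores_aug Q.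

Definition theta_l (W X : set A) M (P : resolution W M) (Q : resolution X M)
    (f : cmap P Q) N n : {additive relExt_l Q N n -> relExt_l P N n} :=
  homology_map (homl_map N f) (n := - n).

Definition theta_r (Y V : set A) N (P : coresolution Y N)
    (Q : coresolution V N) (f : cmap P Q) M n :
    {additive relExt_r M P n -> relExt_r M Q n} :=
  homology_map (homr_map M f) (n := - n).

End Complexes.

(* Main.v *)
(* The point of (a) is that the cone K of W -> X (the lift of id_M) is exact and
   that Hom(K, N) is exact as well.

   If C is an exact complex bounded below whose terms have vanishing Ext into V,
   then Hom(C, V) is exact. As Ext consists of Yoneda classes, this dimension
   shift needs a description of the trivial classes: an extension
   0 -> V -> E_n -> ... -> E_1 -> Z -> 0 is trivial only if the map from
   V -> E_n -> ... -> E_1 onto its term V factors through an acyclic complex, a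
   property which passes along morphisms of extensions in both directions.

   Hence Hom(K, S_i) is exact for a bounded V-coresolution S of N, and S is
   proper, so that by hypothesis Hom(w, S) is exact in negative degrees for w in
   W. Embedding an object of X in one of W with cokernel in X, a descending
   induction extends this to X, and then Hom(K, N) is exact by splicing.

   Part (b) is (a) in the opposite category. Exactness is tested throughout on
   generalized elements, that is, up to precomposition with epimorphisms. *)
Require Import Defs.
From Stdlib Require Import Relations.
From mathcomp Require Import all_boot all_order all_algebra.
From mathcomp Require Import all_classical.
From mathcomp Require Import zify.

Set Implicit Arguments.
Unset Strict Implicit.
Unset Printing Implicit Defensive.

(* MathComp's [vector] also exports a constant named [hom]. *)
Import Defs Order.TTheory GRing.Theory Num.Theory.
Local Open Scope classical_set_scope.
Local Open Scope ring_scope.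

(** * Abelian categories: biproducts, pullbacks, exactness on generalized elements *)

Section Abelian.
Variable A : abelian.
Implicit Types X Y Z T U : A.

Lemma compNm X Y Z (g : hom Y Z) (f : hom X Y) : (- g) \c f = - (g \c f).
Proof. by apply/eqP; rewrite -addr_eq0 -compDl addNr comp0m. Qed.

Lemma compmN X Y Z (g : hom Y Z) (f : hom X Y) : g \c (- f) = - (g \c f).
Proof. by apply/eqP; rewrite -addr_eq0 -compDr addNr compm0. Qed.

Lemma compBl X Y Z (g g' : hom Y Z) (f : hom X Y) :
  (g - g') \c f = g \c f - g' \c f.
Proof. by rewrite compDl compNm. Qed.

Lemma compBr X Y Z (g : hom Y Z) (f f' : hom X Y) :
  g \c (f - f') = g \c f - g \c f'.
Proof. by rewrite compDr compmN. Qed.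

Lemma epi0 X Y (f : hom X Y) :
  (forall T (u : hom Y T), u \c f = 0 -> u = 0) -> epi f.
Proof.
move=> f0 T u v uv; apply/eqP; rewrite -subr_eq0; apply/eqP/f0.
by rewrite compBl uv subrr.
Qed.

Lemma epi_eq0 X Y T (f : hom X Y) (u : hom Y T) : epi f -> u \c f = 0 -> u = 0.
Proof. by move=> ef uf; apply: ef; rewrite uf comp0m. Qed.

Lemma mono0 X Y (f : hom X Y) :
  (forall T (u : hom T X), f \c u = 0 -> u = 0) -> mono f.
Proof.
move=> f0 T u v uv; apply/eqP; rewrite -subr_eq0; apply/eqP/f0.
by rewrite compBr uv subrr.
Qed.

Lemma mono_eq0 X Y T (f : hom X Y) (u : hom T X) :
  mono f -> f \c u = 0 -> u = 0.
Proof. by move=> ef uf; apply: ef; rewrite uf compm0. Qed.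

Lemma epi_id X : epi (idm X).
Proof. by move=> T u v; rewrite !compm1. Qed.

Lemma epi_comp X Y Z (g : hom Y Z) (f : hom X Y) : epi g -> epi f -> epi (g \c f).
Proof. by move=> eg ef T u v; rewrite !compA => /ef/eg. Qed.

Lemma epi_of_comp X Y Z (g : hom Y Z) (f : hom X Y) : epi (g \c f) -> epi g.
Proof. by move=> e T u v uv; apply: e; rewrite !compA uv. Qed.

Lemma kernel_mono X Y K (f : hom X Y) (k : hom K X) : is_kernel f k -> mono k.
Proof.
move=> [fk uk]; apply: mono0 => T u ku.
have [w [_ w_uniq]] := uk T 0 (compm0 _ _).
by rewrite -(w_uniq u ku) (w_uniq 0) ?compm0.
Qed.

Lemma cokernel_epi X Y Q (f : hom X Y) (q : hom Y Q) : is_cokernel f q -> epi q.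
Proof.
move=> [qf uq]; apply: epi0 => T u qu.
have [w [_ w_uniq]] := uq T 0 (comp0m _ _).
by rewrite -(w_uniq u qu) (w_uniq 0) ?comp0m.
Qed.

Lemma zero_to Z T (f : hom T Z) : is_zero Z -> f = 0.
Proof. by move=> /(_ T)[]. Qed.

Lemma zero_from Z T (f : hom Z T) : is_zero Z -> f = 0.
Proof. by move=> /(_ T)[]. Qed.

Lemma epi_cokernel_kernel X Y K (f : hom X Y) (k : hom K X) :
  epi f -> is_kernel f k -> is_cokernel k f.
Proof.
move=> ef [fk uk]; split=> // T t tk.
have [Z [g [fg ug]]] := ab_epi ef.
have [h [kh _]] := uk _ g fg.
have tg : t \c g = 0 by rewrite -kh compA tk comp0m.
exact: ug.
Qed.

Record biproduct X Y := Biproduct {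
  bsum :> A;
  bin1 : hom X bsum; bin2 : hom Y bsum;
  bpr1 : hom bsum X; bpr2 : hom bsum Y;
  bpr1_in1 : bpr1 \c bin1 = idm X; bpr2_in2 : bpr2 \c bin2 = idm Y;
  bpr1_in2 : bpr1 \c bin2 = 0; bpr2_in1 : bpr2 \c bin1 = 0;
  bsumE : bin1 \c bpr1 + bin2 \c bpr2 = idm bsum }.

Lemma ex_biproduct X Y : exists B : biproduct X Y, True.
Proof.
have [B [i [j [p [q [h1 h2 h3 h4 h5]]]]]] := ab_biproduct X Y.
by exists (Biproduct h1 h2 h3 h4 h5).
Qed.

Definition dsum X Y : biproduct X Y := projT1 (cid (ex_biproduct X Y)).

Definition in1 X Y : hom X (dsum X Y) := bin1 _.
Definition in2 X Y : hom Y (dsum X Y) := bin2 _.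
Definition pr1 X Y : hom (dsum X Y) X := bpr1 _.
Definition pr2 X Y : hom (dsum X Y) Y := bpr2 _.
Arguments in1 {X Y}. Arguments in2 {X Y}. Arguments pr1 {X Y}. Arguments pr2 {X Y}.

Definition pairm X Y T (f : hom T X) (g : hom T Y) : hom T (dsum X Y) :=
  in1 \c f + in2 \c g.
Definition copairm X Y T (f : hom X T) (g : hom Y T) : hom (dsum X Y) T :=
  f \c pr1 + g \c pr2.

Lemma dsum_biproduct X Y : is_biproduct X Y (dsum X Y).
Proof.
exists in1, in2, pr1, pr2.
by split; [exact: bpr1_in1|exact: bpr2_in2|exact: bpr1_in2|exact: bpr2_in1|exact: bsumE].
Qed.

Lemma pr1_pair X Y T (f : hom T X) (g : hom T Y) : pr1 \c pairm f g = f.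
Proof. by rewrite compDr !compA bpr1_in1 bpr1_in2 comp0m comp1m addr0. Qed.

Lemma pr2_pair X Y T (f : hom T X) (g : hom T Y) : pr2 \c pairm f g = g.
Proof. by rewrite compDr !compA bpr2_in2 bpr2_in1 comp0m comp1m add0r. Qed.

Lemma copair_in1 X Y T (f : hom X T) (g : hom Y T) : copairm f g \c in1 = f.
Proof. by rewrite compDl -!compA bpr1_in1 bpr2_in1 compm0 compm1 addr0. Qed.

Lemma copair_in2 X Y T (f : hom X T) (g : hom Y T) : copairm f g \c in2 = g.
Proof. by rewrite compDl -!compA bpr1_in2 bpr2_in2 compm0 compm1 add0r. Qed.

Lemma pairE X Y T (t : hom T (dsum X Y)) : t = pairm (pr1 \c t) (pr2 \c t).
Proof. by rewrite /pairm !compA -compDl bsumE comp1m. Qed.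

Lemma copairE X Y T (t : hom (dsum X Y) T) : t = copairm (t \c in1) (t \c in2).
Proof. by rewrite /copairm -!compA -compDr bsumE compm1. Qed.

Lemma dsum_ext X Y T (t u : hom T (dsum X Y)) :
  pr1 \c t = pr1 \c u -> pr2 \c t = pr2 \c u -> t = u.
Proof. by move=> e1 e2; rewrite (pairE t) (pairE u) e1 e2. Qed.

Lemma copair_pair X Y T U (f : hom X U) (g : hom Y U) (a : hom T X) (b : hom T Y) :
  copairm f g \c pairm a b = f \c a + g \c b.
Proof. by rewrite compDl -!compA pr1_pair pr2_pair. Qed.

Lemma pair_comp X Y T U (a : hom T X) (b : hom T Y) (u : hom U T) :
  pairm a b \c u = pairm (a \c u) (b \c u).
Proof. by rewrite compDl -!compA. Qed.

Lemma dsum_zero X Y : is_zero X -> is_zero Y -> is_zero (dsum X Y).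
Proof.
move=> X0 Y0 T; split=> f.
  by apply: dsum_ext; rewrite compm0; apply: zero_to.
rewrite (copairE f) (zero_from (f \c in1) X0) (zero_from (f \c in2) Y0).
by rewrite /copairm !comp0m addr0.
Qed.

(* The generalized element [t] lies in the image of [f]. *)
Definition lifts X Y T (f : hom X Y) (t : hom T Y) :=
  exists T' (e : hom T' T) (s : hom T' X), epi e /\ f \c s = t \c e.

Definition lex X Y Z (f : hom X Y) (g : hom Y Z) :=
  forall T (t : hom T Y), g \c t = 0 -> lifts f t.

Record pullback X Y Z (f : hom X Z) (g : hom Y Z) := Pullback {
  pb :> A;
  pb1 : hom pb X;
  pb2 : hom pb Y;
  pb_comm : f \c pb1 = g \c pb2;
  pb_ex : forall T (a : hom T X) (b : hom T Y), f \c a = g \c b ->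
    exists t : hom T pb, pb1 \c t = a /\ pb2 \c t = b;
  pb_uniq : forall T (t u : hom T pb),
    pb1 \c t = pb1 \c u -> pb2 \c t = pb2 \c u -> t = u;
  pb_epi : epi f -> epi pb2 }.

(** The pullback is the kernel of [h = (f, -g)]. If [f] is epi then so is [h], which is thus the
    cokernel of that kernel: a map [u] killing the second projection has [u \c pr2 = y \c h], where
    [y \c f = 0] and so [y = 0]. *)
Lemma ex_pullback X Y Z (f : hom X Z) (g : hom Y Z) :
  exists P : pullback f g, True.
Proof.
pose h := copairm f (- g); have [K [k kk]] := ab_kernel h.
have hk := kk.1.
have comm : f \c (pr1 \c k) = g \c (pr2 \c k).
  apply/eqP; rewrite -subr_eq0 -compNm; apply/eqP.
  by rewrite -hk compDl !compA.
have ex T (a : hom T X) (b : hom T Y) : f \c a = g \c b ->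
    exists t : hom T K, pr1 \c k \c t = a /\ pr2 \c k \c t = b.
  move=> ab; have : h \c pairm a b = 0 by rewrite copair_pair compNm ab subrr.
  move=> /(kk.2 _)[t [kt _]]; exists t.
  by rewrite -!compA kt pr1_pair pr2_pair.
have un T (t u : hom T K) : pr1 \c k \c t = pr1 \c k \c u ->
    pr2 \c k \c t = pr2 \c k \c u -> t = u.
  by rewrite -!compA => e1 e2; apply: (kernel_mono kk); apply: dsum_ext.
suff ep : epi f -> epi (pr2 \c k) by exists (Pullback comm ex un ep).
move=> ef; apply: epi0 => T u uk.
have eh : epi h by apply: (@epi_of_comp _ _ _ _ in1); rewrite copair_in1.
have [|y [yh _]] := (epi_cokernel_kernel eh kk).2 _ (u \c pr2).
  by rewrite -compA uk.
have y0 : y = 0.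
  apply: (epi_eq0 ef); rewrite -(copair_in1 f (- g)) compA yh -compA.
  by rewrite bpr2_in1 compm0.
by rewrite -[u]compm1 -(bpr2_in2 (dsum X Y)) compA -[_ \c bpr2 _]yh y0 !comp0m.
Qed.

Definition pull X Y Z (f : hom X Z) (g : hom Y Z) : pullback f g :=
  projT1 (cid (ex_pullback f g)).

Lemma epi_lift X Y T (f : hom X Y) (t : hom T Y) : epi f -> lifts f t.
Proof.
move=> ef; pose P := pull f t; exists P, (pb2 P), (pb1 P).
by split; [exact: pb_epi|exact: pb_comm].
Qed.

Lemma lift_epi X Y (f : hom X Y) : (forall T (t : hom T Y), lifts f t) -> epi f.
Proof.
move=> /(_ _ (idm Y))[T [e [s [ee]]]]; rewrite comp1m => fs.
by apply: (@epi_of_comp _ _ _ _ s); rewrite fs.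
Qed.

(** It suffices that the factor [h'] of [h] through the kernel [k] of [q] is epi. If [c] kills [h']
    and has kernel [m], the mono [k \c m] is the kernel of some [g], which kills [h], hence factors
    through [q] and kills [k]; so [m] has a right inverse and [c = 0]. *)
Lemma cokernel_lex X Y Q (h : hom X Y) (q : hom Y Q) : is_cokernel h q -> lex h q.
Proof.
move=> [qh uq] T t qt; have [K [k kk]] := ab_kernel q.
have [h' [kh' _]] := kk.2 _ h qh.
suff eh' : epi h'.
  have [t' [kt' _]] := kk.2 _ t qt.
  have [T' [e [s [ee es]]]] := epi_lift t' eh'.
  by exists T', e, s; rewrite -kh' -compA es -kt' compA.
apply: epi0 => D c ch'; have [I [m km]] := ab_kernel c.
have mkm : mono (k \c m).
  by move=> U u v; rewrite -!compA => /(kernel_mono kk)/(kernel_mono km).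
have [G [g kg]] := ab_mono mkm.
have [h'' [mh'' _]] := km.2 _ h' ch'.
have gh : g \c h = 0 by rewrite -kh' -mh'' !compA -(compA g) kg.1 comp0m.
have [g' [g'q _]] := uq _ g gh.
have gk : g \c k = 0 by rewrite -g'q -compA kk.1 compm0.
have [r [kmr _]] := kg.2 _ k gk.
have mr : m \c r = idm K by apply: (kernel_mono kk); rewrite compA kmr compm1.
by rewrite -[c]compm1 -mr compA km.1 comp0m.
Qed.

Lemma epi_factor X Y Z T (f : hom X Y) (g : hom Y Z) (v : hom Y T) :
  lex f g -> epi g -> v \c f = 0 -> exists w : hom Z T, w \c g = v.
Proof.
move=> fg eg vf; have [K [k kk]] := ab_kernel g.
have vk : v \c k = 0.
  have [T' [e [s [ee es]]]] := fg _ k kk.1.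
  by apply: (epi_eq0 ee); rewrite -compA -es compA vf comp0m.
by have [w [wg _]] := (epi_cokernel_kernel eg kk).2 _ v vk; exists w.
Qed.

Lemma lex_homology0 X Y Z H (f : hom X Y) (g : hom Y Z) :
  is_zero H -> is_homology f g H -> lex f g.
Proof.
move=> H0 [K [k [f' [p [kk kf' cp]]]]] T t gt.
have [t' [kt' _]] := kk.2 _ t gt.
have ef' : epi f'.
  apply: epi0 => D u uf'; have [w [<- _]] := cp.2 _ u uf'.
  by rewrite (zero_from w H0) comp0m.
have [T' [e [s [ee es]]]] := epi_lift t' ef'.
by exists T', e, s; split=> //; rewrite -kf' -compA es -kt' compA.
Qed.

Lemma homology0_lex X Y Z H (f : hom X Y) (g : hom Y Z) :
  is_zero H -> g \c f = 0 -> lex f g -> is_homology f g H.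
Proof.
move=> H0 gf fg; have [K [k kk]] := ab_kernel g.
have [f' [kf' _]] := kk.2 _ f gf; exists K, k, f', 0; split=> //.
have ef' : epi f'.
  have [T' [e [s [ee es]]]] := fg _ k kk.1.
  apply: (@epi_of_comp _ _ _ _ s); rewrite (_ : f' \c s = e) //.
  by apply: (kernel_mono kk); rewrite compA kf'.
split=> [|T t tf']; first by rewrite comp0m.
exists 0; split=> [|u _]; first by rewrite (epi_eq0 ef' tf') comp0m.
by rewrite (zero_from u H0).
Qed.

End Abelian.
Arguments in1 {A X Y}. Arguments in2 {A X Y}.
Arguments pr1 {A X Y}. Arguments pr2 {A X Y}.

(** * Chain complexes in nonnegative degrees: acyclicity, quasi-isomorphisms, cones *)

Section Chains.
Variable A : abelian.
Implicit Types X Y Z T U : A.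

Record chain := Chain {
  cob :> nat -> A;
  dif : forall i, hom (cob i.+1) (cob i);
  difdif : forall i, dif i \c dif i.+1 = 0 }.

Definition cyc (C : chain) i T : hom T (C i) -> Prop :=
  match i return hom T (C i) -> Prop with
  | 0%N => fun=> True
  | j.+1 => fun t => dif C j \c t = 0
  end.

Definition acyclic (C : chain) :=
  forall i T (t : hom T (C i)), cyc t -> lifts (dif C i) t.

Definition chmap (C D : chain) (g : forall i, hom (C i) (D i)) :=
  forall i, g i \c dif C i = dif D i \c g i.+1.

Lemma cyc_comp (C : chain) i T T' (t : hom T (C i)) (e : hom T' T) :
  cyc t -> cyc (t \c e).
Proof. by case: i t => //= i t t0; rewrite compA t0 comp0m. Qed.

Lemma cyc_map (C D : chain) g i T (t : hom T (C i)) :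
  @chmap C D g -> cyc t -> cyc (g i \c t).
Proof.
by case: i t => //= i t hg t0; rewrite compA -hg -compA t0 compm0.
Qed.

Lemma cycB (C : chain) i T (t u : hom T (C i)) : cyc t -> cyc u -> cyc (t - u).
Proof. by case: i t u => //= i t u t0 u0; rewrite compBr t0 u0 subrr. Qed.

(* [g] is bijective on homology: the two clauses are surjectivity and
   injectivity, tested on generalized elements. *)
Definition qiso (E D : chain) (g : forall i, hom (E i) (D i)) :=
  (forall i T (t : hom T (D i)), cyc t ->
     exists T' (e : hom T' T) (s : hom T' (E i)) (x : hom T' (D i.+1)),
       [/\ epi e, cyc s & g i \c s + dif D i \c x = t \c e]) /\
  (forall i T (s : hom T (E i)) (x : hom T (D i.+1)), cyc s ->
     g i \c s = dif D i \c x -> lifts (dif E i) s).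

Section Cone.
Variables (E D : chain) (g : forall i, hom (E i) (D i)).
Hypothesis gP : chmap g.

Definition cone_ob i : A := if i is j.+1 then dsum (D i) (E j) else D i.

Definition cone_dif i : hom (cone_ob i.+1) (cone_ob i) :=
  match i with
  | 0%N => copairm (dif D 0) (g 0)
  | j.+1 => pairm (copairm (dif D j.+1) (g j.+1)) (- (dif E j \c pr2))
  end.

Lemma cone_difdif i : cone_dif i \c cone_dif i.+1 = 0.
Proof.
case: i => [|i] /=.
  rewrite copair_pair [X in dif D 0 \c X]/copairm compDr !compA difdif comp0m.
  by rewrite add0r compmN !compA gP subrr.
rewrite pair_comp copair_pair; apply: dsum_ext.
  rewrite pr1_pair compm0 /copairm compDr !compA difdif comp0m add0r.
  by rewrite compmN !compA gP subrr.
rewrite pr2_pair compm0 compNm -compA pr2_pair compmN opprK compA difdif.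
by rewrite comp0m.
Qed.

Definition cone := Chain cone_difdif.

(** In a cycle [(a, s)] of positive degree, [s] is a cycle with [g s = - d a]. Injectivity on
    homology gives [s = d s1]; then [a + g s1] is a cycle, which surjectivity writes as
    [g s2 + d x2] with [s2] a cycle, and [(x2, s2 - s1)] bounds [(a, s)]. *)
Lemma cone_acyclic : qiso g -> acyclic cone.
Proof.
move=> [surj inj] [|i] T t tcyc.
  have [T' [e [s [x [ee _ sx]]]]] := surj 0%N T t I.
  exists T', e, (pairm x s); split=> //=.
  by rewrite copair_pair addrC.
have ecyc : cyc (pr2 \c t) /\ g i \c (pr2 \c t) = dif D i \c (- (pr1 \c t)).
  case: i t tcyc => [|i] t /= tcyc.
    split=> //; apply/eqP; rewrite compmN -addr_eq0 addrC.
    by rewrite -tcyc /copairm compDl !compA.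
  move: tcyc; rewrite pair_comp => tcyc; split.
    by have := congr1 (fun h => - (pr2 \c h)) tcyc;
      rewrite pr2_pair compm0 compNm opprK oppr0 -compA.
  apply/eqP; rewrite compmN -addr_eq0 addrC.
  have := congr1 (fun h => pr1 \c h) tcyc.
  by rewrite pr1_pair compm0 /copairm compDl !compA => ->.
have [T1 [e1 [s1 [ee1 es1]]]] := inj _ _ _ _ ecyc.1 ecyc.2.
have [|T2 [e2 [s2 [x2 [ee2 s2cyc es2]]]]] :=
    surj i.+1 T1 (pr1 \c t \c e1 + g i.+1 \c s1).
  rewrite /= compDr !compA -gP -[g i \c _ \c _]compA es1 !compA.
  rewrite -[g i \c _ \c _]compA ecyc.2 compmN compNm !compA.
  by rewrite subrr.
exists T2, (e1 \c e2), (pairm x2 (s2 - s1 \c e2)); split; first exact: epi_comp.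
rewrite /= pair_comp copair_pair; apply: dsum_ext.
  rewrite pr1_pair compBr addrA [_ + g _ \c s2]addrC es2 compDl !compA.
  by rewrite addrK.
rewrite pr2_pair compNm -compA pr2_pair compBr compA es1 s2cyc.
by rewrite sub0r opprK !compA.
Qed.

End Cone.

Section Sum.
Variables E D : chain.

Definition sum_dif i : hom (dsum (E i.+1) (D i.+1)) (dsum (E i) (D i)) :=
  pairm (dif E i \c pr1) (dif D i \c pr2).

Lemma sum_difdif i : sum_dif i \c sum_dif i.+1 = 0.
Proof.
rewrite pair_comp -!compA pr1_pair pr2_pair !compA !difdif !comp0m.
by rewrite /pairm !compm0 addr0.
Qed.

Definition csum := @Chain (fun i => dsum (E i) (D i)) sum_dif sum_difdif.

Lemma csum_cyc i T (t : hom T (csum i)) :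
  cyc t <-> cyc (pr1 \c t : hom T (E i)) /\ cyc (pr2 \c t : hom T (D i)).
Proof.
case: i t => [|i] t /=; first by [].
rewrite pair_comp; split=> [h|[h1 h2]].
  have h1 := congr1 (fun h => pr1 \c h) h.
  have h2 := congr1 (fun h => pr2 \c h) h.
  by move: h1 h2; rewrite pr1_pair pr2_pair !compm0 !compA.
by apply: dsum_ext; rewrite ?pr1_pair ?pr2_pair compm0 -compA.
Qed.

End Sum.

Section Cons.
Variables (X : A) (C : chain) (r : hom (C 0%N) X).
Hypothesis rd : r \c dif C 0 = 0.

Definition cons_ob i : A := if i is j.+1 then C j else X.

Definition cons_dif i : hom (cons_ob i.+1) (cons_ob i) :=
  if i is j.+1 then dif C j else r.

Lemma cons_difdif i : cons_dif i \c cons_dif i.+1 = 0.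
Proof. by case: i => //= i; apply: difdif. Qed.

Definition ccons := Chain cons_difdif.

End Cons.

Definition shift (C : chain) : chain :=
  Chain (fun i => difdif C i.+1).

Definition resol (C : chain) X (r : hom (C 0%N) X) :=
  [/\ epi r, r \c dif C 0 = 0, lex (dif C 0) r
    & forall i, lex (dif C i.+1) (dif C i)].

(** Both complexes have homology only in degree 0, where it is [X], and [g] induces the identity
    there. *)
Lemma qiso_resol (E D : chain) X (r : hom (E 0%N) X) (r' : hom (D 0%N) X)
    (g : forall i, hom (E i) (D i)) :
  chmap g -> resol r -> resol r' -> r' \c g 0 = r -> qiso g.
Proof.
move=> gP [er rd exr exE] [er' rd' exr' exD] gr; split.
  case=> [|i] T t tcyc.
    have [T1 [e1 [s1 [ee1 es1]]]] := epi_lift (r' \c t) er.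
    have [|T2 [e2 [s2 [ee2 es2]]]] := exr' T1 (t \c e1 - g 0 \c s1).
      by rewrite compBr !compA gr es1 subrr.
    exists T2, (e1 \c e2), (s1 \c e2), s2; split=> //; first exact: epi_comp.
    by rewrite es2 compBl !compA addrC subrK.
  have [T1 [e1 [s1 [ee1 es1]]]] := exD _ _ _ tcyc.
  exists T1, e1, 0, s1; split=> //=; first by rewrite compm0.
  by rewrite compm0 add0r.
case=> [|i] T s x scyc gs; last exact: exE.
by apply: exr; rewrite -gr -compA gs compA rd' comp0m.
Qed.

Lemma qiso_sum (E L D : chain) (p : forall i, hom (E i) (L i))
    (g : forall i, hom (E i) (D i)) :
  acyclic L -> chmap p -> chmap g -> qiso g ->
  @qiso E (csum L D) (fun i => pairm (p i) (g i)).
Proof.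
move=> exL pP gP [surj inj]; split.
  move=> i T t /csum_cyc[t1 t2].
  have [T1 [e1 [s1 [x1 [ee1 s1cyc es1]]]]] := surj _ _ _ t2.
  have [|T2 [e2 [s2 [ee2 es2]]]] := exL _ T1 (pr1 \c t \c e1 - p i \c s1).
    by apply: cycB; [exact: cyc_comp|exact: cyc_map].
  exists T2, (e1 \c e2), (s1 \c e2), (pairm s2 (x1 \c e2)).
  split; [exact: epi_comp|exact: cyc_comp|].
  rewrite /= !pair_comp -!compA pr1_pair pr2_pair.
  apply: dsum_ext; rewrite compDr ?pr1_pair ?pr2_pair.
    by rewrite es2 compBl !compA addrC subrK.
  by rewrite !compA -compDl es1.
move=> i T s x scyc; rewrite pair_comp /= => h.
apply: (inj _ _ s (pr2 \c x)) => //.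
by have := congr1 (fun h => pr2 \c h) h; rewrite pair_comp !pr2_pair !compA.
Qed.

Lemma pair_chmap (E L D : chain) (p : forall i, hom (E i) (L i))
    (g : forall i, hom (E i) (D i)) : chmap p -> chmap g ->
  @chmap E (csum L D) (fun i => pairm (p i) (g i)).
Proof.
move=> pP gP i; rewrite /= !pair_comp -!compA pr1_pair pr2_pair.
by rewrite !pP !gP.
Qed.

Lemma inject_chmap (E D : chain) (g : forall i, hom (E i) (D i)) (gP : chmap g) :
  @chmap D (cone gP) (fun i => if i is j.+1 then in1 else idm _).
Proof.
case=> [|i] /=; first by rewrite comp1m copair_in1.
apply: dsum_ext; rewrite pair_comp ?pr1_pair ?pr2_pair ?copair_in1 compA.
  by rewrite bpr1_in1 comp1m.
by rewrite bpr2_in1 comp0m compNm -compA bpr2_in1 compm0 oppr0.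
Qed.

End Chains.

(** * Pushing out a truncated exact complex *)

Section Pushout.
Variable A : abelian.
Implicit Types X Y Z T U V : A.

Definition zero_obj : A := projT1 (cid (ab_zero A)).

Lemma zero_objP : is_zero zero_obj.
Proof. exact: (projT2 (cid (ab_zero A))). Qed.

Definition conc_ob V (i : nat) : A := if i is 0%N then V else zero_obj.

Definition conc V : chain A :=
  @Chain A (conc_ob V) (fun=> 0) (fun=> comp0m _ _).

Lemma lift0 X Y T (f : hom X Y) : lifts f (0 : hom T Y).
Proof.
by exists T, (idm T), 0; split; [exact: epi_id|rewrite compm0 comp0m].
Qed.

(* Exactness of [... -> C 1 -> C 0 -> X] away from [X]. *)
Definition exover (C : chain A) X (r : hom (C 0%N) X) :=
  [/\ r \c dif C 0 = 0, lex (dif C 0) r & forall i, lex (dif C i.+1) (dif C i)].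

(* [C] is [B] truncated at degree [k.+1] and pushed out along [v]. The last
   clause is only there for the induction, where [X] becomes [B 0]. *)
Lemma pushout_exover k (B : chain A) X (r : hom (B 0%N) X) V
    (v : hom (B k.+1) V) :
  exover r -> v \c dif B k.+1 = 0 ->
  exists (C : chain A) (r' : hom (C 0%N) X) (g : forall i, hom (B i) (C i))
         (b : hom V (C k.+1)),
    [/\ [/\ chmap g, r' \c g 0%N = r & exover r'],
        is_iso b, g k.+1 = b \c v, forall j, (k.+1 < j)%N -> is_zero (C j)
      & forall Y (s : hom X Y), s \c r = 0 -> s \c r' = 0].
Proof.
elim: k B X r v => [|k IHk] B X r v [rd exr exB] vd.
  (* [Q] is the pushout of [v] and [dif B 0]; the new complex is [V -> Q]. *)
  pose h := pairm v (- dif B 0); have [Q [q qq]] := ab_cokernel h.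
  have eq := cokernel_epi qq; have [qh qu] := qq.
  have [|r' [r'q _]] := qu X (copairm 0 r).
    by rewrite copair_pair comp0m add0r compmN rd oppr0.
  have r'in1 : r' \c (q \c in1) = 0 by rewrite compA r'q copair_in1.
  have r'in2 : r' \c (q \c in2) = r by rewrite compA r'q copair_in2.
  have qd0 : q \c in1 \c dif (conc V) 0 = 0 by rewrite compm0.
  pose g i : hom (B i) (ccons qd0 i) :=
    match i with 0%N => q \c in2 | 1%N => v | _ => 0 end.
  have qhE : q \c in1 \c v = q \c in2 \c dif B 0.
    apply/eqP; rewrite -subr_eq0 -compmN -!compA -compDr; apply/eqP.
    exact: qh.
  exists (ccons qd0), r', g, (idm V); split.
  - split=> //.
    + case=> [|[|i]] /=; rewrite ?vd ?comp0m //.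
    + split; first exact: r'in1.
      * move=> T t r't; have [T1 [e1 [s1 [ee1 es1]]]] := epi_lift t eq.
        have [|T2 [e2 [s2 [ee2 es2]]]] := exr T1 (pr2 \c s1).
          have <- : r' \c (t \c e1) = 0 by rewrite compA r't comp0m.
          by rewrite -es1 [RHS]compA r'q /copairm comp0m add0r compA.
        exists T2, (e1 \c e2), (pr1 \c s1 \c e2 + v \c s2).
        split; first exact: epi_comp.
        have -> : t \c (e1 \c e2) = q \c (s1 \c e2) by rewrite !compA es1.
        rewrite /= compDr [X in _ + X]compA qhE -[X in _ + X]compA es2 -!compA.
        by rewrite -compDr [s1 \c e2 in RHS]pairE.
      (* [V -> Q] is mono: if [t] dies in [Q], then [(t, 0)] is locally [(v s1, - d s1)]; as
         [d s1 = 0], [s1] is locally a boundary and [v] kills it. *)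
      * case=> [|i] T t tz /=; last first.
          by rewrite (zero_to t zero_objP); exact: lift0.
        have [|T1 [e1 [s1 [ee1 es1]]]] := cokernel_lex qq (t := in1 \c t).
          by rewrite compA.
        have e2 : dif B 0 \c s1 = 0.
          have := congr1 (fun h => - (pr2 \c h)) es1.
          rewrite !compA pr2_pair bpr2_in1 !comp0m oppr0.
          by rewrite compNm opprK.
        have [T2 [e' [s2 [ee2 es2]]]] := exB _ _ _ e2.
        have e1' : v \c s1 = t \c e1.
          have := congr1 (fun h => pr1 \c h) es1.
          by rewrite !compA pr1_pair bpr1_in1 comp1m.
        suff -> : t = 0 by apply: lift0.
        apply: (epi_eq0 ee1); apply: (epi_eq0 ee2).
        by rewrite -e1' -compA -es2 compA vd comp0m.
  - by exists (idm V); rewrite comp1m.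
  - by rewrite comp1m.
  - by case=> [|[|j]] //= _; exact: zero_objP.
  - move=> Y s sr; apply: (epi_eq0 eq); rewrite -compA r'q /copairm comp0m.
    by rewrite add0r compA sr comp0m.
(* The shift, which lies over [B 0], is pushed out and [B 0] is put back in front; the last clause,
   for [s = r], gives [r \c r' = 0]. *)
have exs : @exover (shift B) (B 0%N) (dif B 0).
  by split; [exact: difdif|exact: exB|move=> i; exact: exB].
have [C [r' [g [b [[gP r'g [r'd exr' exC]] bi gb C0 uni]]]]] :=
  IHk (shift B) _ _ v exs vd.
pose g' i : hom (B i) (ccons r'd i) :=
  match i with 0%N => idm (B 0%N) | j.+1 => g j end.
exists (ccons r'd), r, g', b; split=> //.
- split; last split.
  + by case=> [|i] /=; rewrite ?comp1m ?r'g //; apply: gP.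
  + by rewrite compm1.
  + exact: uni.
  + move=> T t rt; have [T1 [e1 [s1 [ee1 es1]]]] := exr _ _ rt.
    by exists T1, e1, (g 0%N \c s1); rewrite /= compA r'g.
  + by case=> [|i]; [exact: exr'|exact: exC].
- by case=> [|j] //= kj; exact: C0.
Qed.

End Pushout.

(** * Yoneda extensions, their trivial classes, and dimension shifting *)

Section Extensions.
Variable A : abelian.
Implicit Types X Y Z T U V : A.

Lemma exact_atP (C : complex A) (p n m : int) : p = n + 1 -> m = n - 1 ->
  exact_at C n <-> lex (cd C p n) (cd C n m).
Proof.
move=> -> ->; split=> [[H [H0 hH]]|ex]; first exact: lex_homology0 hH.
exists (zero_obj A); split; first exact: zero_objP.
by apply: homology0_lex => //; [exact: zero_objP|exact: cdd].
Qed.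

Lemma isoP X Y (f : hom X Y) (g : hom Y X) :
  g \c f = idm X -> f \c g = idm Y -> is_iso f.
Proof. by move=> gf fg; exists g. Qed.

Section OfChain.
Variable C : chain A.

Definition dif_nat m n : hom (C m) (C n) :=
  if m =P n.+1 is ReflectT e
  then eq_rect_r (fun m => hom (C m) (C n)) (dif C n) e else 0.

Lemma dif_natS n : dif_nat n.+1 n = dif C n.
Proof. by rewrite /dif_nat; case: eqP => // e; rewrite (eq_axiomK e). Qed.

Lemma dif_nat0 m n : m != n.+1 -> dif_nat m n = 0.
Proof. by rewrite /dif_nat; case: eqP. Qed.

Definition cx_ob (i : int) : A := if i is Posz n then C n else zero_obj A.

Definition cx_dif (i j : int) : hom (cx_ob i) (cx_ob j) :=
  match i, j with Posz m, Posz n => dif_nat m n | _, _ => 0 end.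

Fact cx_shape i j : i != j + 1 -> cx_dif i j = 0.
Proof.
case: i j => [m|m] [n|n] //= mn; apply: dif_nat0.
by apply: contraNneq mn => ->; rewrite intS addrC.
Qed.

Fact cx_dd i j k : cx_dif j k \c cx_dif i j = 0.
Proof.
case: i j k => [m|m] [n|n] [p|p] /=; rewrite ?comp0m ?compm0 //.
have [->|mn] := eqVneq m n.+1; last by rewrite (dif_nat0 mn) compm0.
have [->|np] := eqVneq n p.+1; last by rewrite (dif_nat0 np) comp0m.
by rewrite !dif_natS difdif.
Qed.

Definition chain_complex := Complex cx_shape cx_dd.

Lemma chain_complex_exact : acyclic C -> forall i, exact_at chain_complex i.
Proof.
move=> exC [[|n]|n].
- apply/(@exact_atP _ 1%:Z _ (-1)) => // T t _ /=; rewrite dif_natS.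
  exact: (exC 0%N).
- apply/(@exact_atP _ n.+2%:Z _ n%:Z).
  + by rewrite intS addrC.
  + by rewrite [n.+1%:Z]intS addrC addKr.
  + by rewrite /= !dif_natS; exact: (exC n.+1).
- apply/(exact_atP _ erefl erefl) => T t _; rewrite (zero_to t).
    exact: lift0.
  exact: zero_objP.
Qed.

End OfChain.

Section ExtensionOfResolution.
Variables (n : nat) (X V : A) (C : chain A) (r : hom (C 0%N) X).
Hypothesis resr : resol r.
Variable b : hom V (C n).
Hypothesis biso : is_iso b.
Hypothesis C0 : forall j, (n < j)%N -> is_zero (C j).

Let rd : r \c dif C 0 = 0.
Proof. by case: resr. Qed.

Let cx := chain_complex (ccons rd).

Lemma ccons_acyclic : acyclic (ccons rd).
Proof.
case: resr => er _ ex0 exi [|[|i]] T t /=.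
- by move=> _; apply: epi_lift.
- exact: ex0.
- exact: exi.
Qed.

Lemma chain_extension_supp (i : int) : i < 0 \/ n.+1%:Z < i -> is_zero (cx i).
Proof.
case: i => [[|i]|i] [] //; try by move=> _; exact: zero_objP.
by rewrite ltz_nat => /C0.
Qed.

Definition chain_extension : extension n X V :=
  @Extension A n X V cx chain_extension_supp
    (chain_complex_exact ccons_acyclic)
    (idm X) (isoP (comp1m (idm X)) (comp1m (idm X))) b biso.

End ExtensionOfResolution.

Section Triv.
Variables (n : nat) (X V : A).
Implicit Types E F : extension n.+1 X V.

(** The extension without its degree 0: a resolution of [X] with [V], up to isomorphism, in degree
    [n.+1]. *)
Definition tail E : chain A :=
  @Chain A (fun i => ext_cx E i.+1%:Z) (fun i => cd E i.+2%:Z i.+1%:Z)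
    (fun i => cdd _ _ _ _).

Lemma tail_resol E : resol (C := tail E) (ext_top E \c cd E 1 0).
Proof.
have [g [gt tg]] := ext_top_iso E.
split.
- apply: epi_comp; first by move=> T u v uv;
    rewrite -[u]compm1 -[v]compm1 -tg !compA uv.
  have /(@exact_atP _ 1 _ (-1)) ex0 := ext_exact E 0.
  apply: lift_epi => T t; apply: ex0 => //; apply: zero_to.
  by apply: ext_supp; left.
- by rewrite -compA cdd compm0.
- move=> T t tt; have /(@exact_atP _ 2 _ 0) ex1 := ext_exact E 1.
  apply: ex1 => //; rewrite -[cd _ _ _]comp1m -gt -!compA.
  by rewrite [_ \c (_ \c t)]compA tt compm0.
- move=> i; apply/(@exact_atP _ i.+3%:Z i.+2%:Z i.+1%:Z _ _).1; last exact: ext_exact.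
    by rewrite [RHS]addrC -intS.
  by rewrite [i.+2%:Z]intS [RHS]addrC addKr.
Qed.

(* The class of [E] vanishes: the map from the resolution [tail E] of [X] to
   its bottom term [V] factors through an acyclic complex. *)
Definition triv E := exists (L : chain A) (p : forall i, hom (tail E i) (L i))
    (v : hom (L n.+1) V),
  [/\ acyclic L, chmap p, v \c dif L n.+1 = 0 & v \c p n.+1 \c ext_bot E = idm V].

Lemma step_triv E F : ext_step E F -> triv F -> triv E.
Proof.
move=> [f [_ fb]] [L [p [v [exL pP vd vb]]]].
exists L, (fun i => p i \c f i.+1%:Z), v; split=> //.
  by move=> i /=; rewrite -compA cmapP compA (pP i) -compA.
by rewrite -!compA fb compA.
Qed.

(* The acyclic complex for [F] is the homotopy pushout of [L] and [tail F] over
   [tail E], i.e. the cone of [tail E -> L (+) tail F]. *)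
Lemma step_trivV E F : ext_step E F -> triv E -> triv F.
Proof.
move=> [f [ft fb]] [L [p [v [exL pP vd vb]]]].
pose g i : hom (tail E i) (tail F i) := f i.+1%:Z.
have gP : chmap g by move=> i; exact: cmapP.
have gq : qiso g.
  apply: (qiso_resol gP (tail_resol E) (tail_resol F)).
  by rewrite -compA -[cd F 1 0 \c _]cmapP compA ft.
have hP := pair_chmap pP gP.
have [b [bE Eb]] := ext_bot_iso F; have [c [cE Ec]] := ext_bot_iso E.
(* The signs make [v'] vanish on boundaries: those coming from [tail E] are sent to zero because
   [v \c p n.+1] and [b \c g n.+1] both invert [ext_bot E]. *)
pose v' : hom (cone hP n.+1) V := copairm (copairm (- v) b) 0.
exists (cone hP), (fun i => (if i is j.+1 return hom (csum L (tail F) i) (cone hP i)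
   then in1 else idm _) \c in2), v'; split.
- by apply: cone_acyclic; apply: qiso_sum.
- move=> i; rewrite [RHS]compA -(inject_chmap hP i) -!compA; congr (_ \c _).
  apply: dsum_ext; rewrite /= pair_comp ?pr1_pair ?pr2_pair -?compA.
    by rewrite compA bpr1_in2 comp0m bpr1_in2 compm0.
  by rewrite compA bpr2_in2 comp1m bpr2_in2 compm1.
- rewrite /= copair_pair comp0m addr0 [X in _ \c X]/copairm compDr !compA /=.
  rewrite copair_pair /sum_dif.
  rewrite copair_pair !compA compNm vd (zero_from (dif (tail F) _)); last first.
    by apply: ext_supp; right; rewrite ltz_nat.
  rewrite !(oppr0, compm0, comp0m, add0r) compNm (_ : v \c _ = b \c g n.+1).
    by rewrite addNr comp0m.
  rewrite -[v \c _]compm1 -[b \c _]compm1 -Ec !compA vb comp1m.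
  by rewrite -[b \c _ \c _]compA fb bE comp1m.
- by rewrite [v' \c _]compA copair_in1 copair_in2.
Qed.

Lemma ext_equiv_triv E F : ext_equiv E F -> triv E <-> triv F.
Proof.
elim=> [E1 E2 st|E1|E1 E2 _ h|E1 E2 E3 _ h1 _ h2] //.
- by split; [exact: step_trivV|exact: step_triv].
- by rewrite h.
- by rewrite h1.
Qed.

End Triv.

(** The contractible complex [V = V] in degrees [n.+1] and [n]. *)
Lemma ex_disc n V : exists (D : chain A) (b : hom V (D n.+1)) (v : hom (D n.+1) V),
  [/\ acyclic D, v \c b = idm V, b \c v = idm _, v \c dif D n.+1 = 0
    & forall j, (n.+1 < j)%N -> is_zero (D j)].
Proof.
elim: n => [|n [D [b [v [exD vb bv vd D0]]]]].
  have rd : idm V \c dif (conc V) 0 = 0 by rewrite compm0.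
  exists (ccons rd), (idm V), (idm V).
  split; rewrite /= ?comp1m //; last by case=> [|[|j]] //= _; exact: zero_objP.
  case=> [|[|i]] T t /=.
  - by move=> _; apply: epi_lift; exact: epi_id.
  - by rewrite comp1m => ->; exact: lift0.
  - by move=> _; rewrite (zero_to t (@zero_objP A)); exact: lift0.
have rd : (0 : hom (D 0%N) (zero_obj A)) \c dif D 0 = 0 by rewrite comp0m.
exists (ccons rd), b, v; split=> //; last by case=> [|j] //= nj; exact: D0.
case=> [|[|i]] T t /= tc.
- by rewrite (zero_to t (@zero_objP A)); exact: lift0.
- exact: exD.
- exact: exD.
Qed.

(** The split extension: its tail is [V = V] plus [X] in degree 0, and the projection to the first
    summand is the required factorization. *)
Lemma ex_triv_extension n X V : exists E : extension n.+1 X V, triv E.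
Proof.
have [D [b [v [exD vb bv vd D0]]]] := ex_disc n V.
pose C := csum D (conc X).
have Z0 := @zero_objP A.
have rr : @resol A C X pr2.
  have exC i T (t : hom T (C i)) : cyc (pr1 \c t : hom T (D i)) ->
      pr2 \c t = 0 -> lifts (dif C i) t.
    move=> /exD[T1 [e [s [ee es]]]] t2.
    exists T1, e, (pairm s 0); split=> //; apply: dsum_ext;
      rewrite pair_comp ?pr1_pair ?pr2_pair -compA ?pr1_pair ?pr2_pair.
      by rewrite es compA.
    by rewrite compm0 compA t2 comp0m.
  split.
  - by apply: (@epi_of_comp _ _ _ _ _ in2); rewrite bpr2_in2; exact: epi_id.
  - by rewrite pr2_pair comp0m.
  - by move=> T t t2; apply: exC.
  - move=> i T t ti; apply: exC; last exact: zero_to Z0.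
    by have := congr1 (fun h => pr1 \c h) ti; rewrite pair_comp pr1_pair compm0 /= compA.
have bi : is_iso (pairm b 0 : hom V (C n.+1)).
  exists (v \c pr1); split; first by rewrite -compA pr1_pair.
  rewrite pair_comp; apply: dsum_ext.
    by rewrite pr1_pair compA bv comp1m compm1.
  by rewrite pr2_pair comp0m compm1; apply/esym/zero_to/Z0.
have C0 j : (n.+1 < j)%N -> is_zero (C j).
  case: j => // j nj; apply: dsum_zero; [exact: D0|exact: Z0].
exists (chain_extension rr bi C0), D, (fun i => pr1), v; split=> //.
  by move=> i /=; rewrite dif_natS pr1_pair.
by rewrite /= -compA pr1_pair vb.
Qed.

(** [C] is the tail of an extension of [X] by [V], which is equivalent to the split one, and [triv]
    is invariant under equivalence. *)
Lemma Ext_zero_factor n X V (C : chain A) (r : hom (C 0%N) X) (b : hom V (C n.+1)) :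
  Ext_zero n.+1 X V -> resol r -> is_iso b ->
  (forall j, (n.+1 < j)%N -> is_zero (C j)) ->
  exists (L : chain A) (p : forall i, hom (C i) (L i)) (v : hom (L n.+1) V),
    [/\ acyclic L, chmap p, v \c dif L n.+1 = 0 & v \c p n.+1 \c b = idm V].
Proof.
move=> ext0 rr bi C0; have [E0 E0t] := ex_triv_extension n X V.
have /ext_equiv_triv := ext0 E0 (chain_extension rr bi C0).
move=> [/(_ E0t) [L [p [v [exL pP vd vb]]]] _].
exists L, p, v; split=> // i; have := pP i.
by rewrite /= dif_natS.
Qed.

(* Pulling [L] back along [p 0] and pushing it out along [v] gives an extension
   of [C 0] by [V] through which the shift of [p] factors. As that extension is
   trivial, [L] may be replaced by an acyclic complex receiving [shift C]. *)
Lemma hom_acyclic_factor n V (C L : chain A) (p : forall i, hom (C i) (L i))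
    (v : hom (L n.+1) V) :
  acyclic L -> chmap p -> v \c dif L n.+1 = 0 ->
  (forall m i, (m < n)%N -> Ext_zero i.+1 (C m) V) ->
  exists w : hom (C n) V, v \c p n.+1 = w \c dif C n.
Proof.
elim: n C L p v => [|n IHn] C L p v exL pP vd ext0.
  have ed : epi (dif L 0) by apply: lift_epi => T t; apply: (exL 0%N).
  have [w wd] := epi_factor (exL 1%N) ed vd.
  by exists (w \c p 0%N); rewrite -wd -!compA pP.
pose P := pull (dif L 0) (p 0%N).
have ed : epi (dif L 0) by apply: lift_epi => T t; apply: (exL 0%N).
have [|r0 [r01 r02]] := pb_ex P (a := dif L 1) (b := 0).
  by rewrite difdif compm0.
have rd : r0 \c dif (shift (shift L)) 0 = 0.
  by apply: pb_uniq; rewrite compA ?r01 ?r02 ?difdif ?comp0m compm0.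
(* [B] is [... -> L 3 -> L 2 -> P], exact over [C 0]; truncated and pushed out along [v], it becomes
   an extension [D] of [C 0] by [V]. *)
pose B := ccons rd.
have exB : @exover A B (C 0%N) (pb2 P).
  split; first exact: r02.
    move=> T t t2; have [|T1 [e [s [ee es]]]] := exL 1%N T (pb1 P \c t).
      by rewrite /= compA pb_comm -compA t2 compm0.
    exists T1, e, s; split=> //.
    by apply: pb_uniq; rewrite !compA ?r01 ?r02 // t2 !comp0m.
  case=> [|i] T t ti; last exact: (exL i.+3).
  by apply: (exL 2%N); rewrite /= -r01 -compA ti compm0.
have [|q0 [q01 q02]] := pb_ex P (a := p 1%N) (b := dif C 0).
  by rewrite -pP.
pose q i : hom (shift C i) (B i) := match i with 0%N => q0 | j.+1 => p j.+2 end.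
have qP : chmap q.
  case=> [|i]; last exact: pP.
  apply: pb_uniq; rewrite !compA /= ?q01 ?q02 ?r01 ?r02; first exact: pP.
  by rewrite difdif comp0m.
have [D [r [g [b [[gP rg [rD exr exD]] bi gb D0 _]]]]] :=
  pushout_exover (k := n) exB (vd : (v : hom (B n.+1) V) \c dif B n.+1 = 0).
have rr : resol r.
  by split=> //; apply: (@epi_of_comp _ _ _ _ _ (g 0%N)); rewrite rg; exact: pb_epi.
have [M [h [u [exM hP ud ub]]]] := Ext_zero_factor (ext0 0%N n isT) rr bi D0.
have [|m i mn|w wd] := IHn (shift C) M (fun i => h i \c (g i \c q i)) u exM _ ud.
- by move=> i; rewrite -!compA qP [g i \c _]compA gP !compA hP.
- exact: (ext0 m.+1 i).
by exists w; rewrite -wd gb /= !compA ub comp1m.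
Qed.

(** The complex receiving [C] is here [C] itself, by the identity. *)
Lemma acyclic_hom_exact n V (C : chain A) (u : hom (C n.+1) V) :
  acyclic C -> (forall m i, (m < n)%N -> Ext_zero i.+1 (C m) V) ->
  u \c dif C n.+1 = 0 -> exists w : hom (C n) V, u = w \c dif C n.
Proof.
move=> exC ext0 ud.
have [|w wd] := hom_acyclic_factor (p := fun i => idm (C i)) exC _ ud ext0.
  by move=> i; rewrite comp1m compm1.
by exists w; rewrite -wd compm1.
Qed.

End Extensions.

(** * Dimension shifting for complexes indexed by integers *)

Section HomExact.
Variable A : abelian.

Definition lexact (C : complex A) := forall p n m : int, p = n + 1 -> n = m + 1 ->
  lex (cd C p n) (cd C n m).

Lemma lexact_hom (C : complex A) (V : A) (d : nat) (p n q : int) (u : hom (C n) V) :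
  lexact C -> (forall i : int, i < - d%:Z -> is_zero (C i)) ->
  p = n + 1 -> n = q + 1 ->
  (forall (m : int) i, m < q -> Ext_zero i.+1 (C m) V) ->
  u \c cd C p n = 0 -> exists w : hom (C q) V, u = w \c cd C n q.
Proof.
move=> exC C0 pn nq ext0 ud.
have [nd|dn] := ltP n (- d%:Z).
  by exists 0; rewrite (zero_from u (C0 _ nd)) comp0m.
have [k nk] : exists k : nat, n = k%:Z - d%:Z :> int.
  by exists (absz (n + d%:Z)); lia.
pose B := @Chain A (fun i => C (i%:Z - d%:Z))
  (fun i => cd C (i.+1%:Z - d%:Z) (i%:Z - d%:Z)) (fun i => cdd _ _ _ _).
have exB : acyclic B.
  case=> [|i] T t /= ti.
    apply: (exC _ _ (- 1 - d%:Z)); try lia.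
    by apply: zero_to; apply: C0; lia.
  by apply: (exC _ _ (i%:Z - d%:Z)); try lia.
have pk : p = k.+1%:Z - d%:Z by lia.
have {}nq : k%:Z - d%:Z = q + 1 by lia.
clear pn; subst n p; case: k dn nq ext0 u ud => [|k] dn nq ext0 u ud.
  (* Here [n = - d], below which the complex is zero, so the incoming differential is epi. *)
  exists 0; rewrite comp0m; apply: (epi_eq0 _ ud).
  by apply: lift_epi => T t; apply: (exB 0%N).
have qk : q = k%:Z - d%:Z by lia.
subst q; apply: (@acyclic_hom_exact A k V B u exB) => // m i mk.
by apply: ext0; lia.
Qed.

End HomExact.

(** * Hom from acyclic complexes in [X] to objects with a bounded [V]-coresolution *)

Section Core.
Variables (A : abelian) (W X V : set A).
Hypothesis WX : W `<=` X.
Hypothesis cogenW : cogenerator W X.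
Hypothesis Xsum : forall x y : A, X x -> X y -> X (dsum x y).
Hypothesis extXV : forall i x v, X x -> V v -> Ext_zero i.+1 x v.

(** The short exact sequence is an acyclic chain with [x'], [w], [x] in degrees 0, 1, 2, so the
    extension of [u] rests on the vanishing of Ext from [x'] to [v]. *)
Lemma extend_along (x w x' v : A) (f : hom x w) (g : hom w x') (u : hom x v) :
  short_exact f g -> X x' -> V v -> exists u' : hom w v, u = u' \c f.
Proof.
move=> [kf cg] Xx' Vv.
have rd : f \c dif (conc x) 0 = 0 by rewrite compm0.
have rd' : g \c dif (ccons rd) 0 = 0 by exact: kf.1.
apply: (@acyclic_hom_exact A 1 v (ccons rd') u); last by rewrite compm0.
  case=> [|[|[|i]]] T t /= tc.
  - by apply: epi_lift; exact: cokernel_epi cg.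
  - have [s [fs _]] := kf.2 _ t tc.
    by exists T, (idm T), s; split; [exact: epi_id|rewrite compm1].
  - by rewrite (mono_eq0 (kernel_mono kf) tc); exact: lift0.
  - by rewrite (zero_to t (@zero_objP A)); exact: lift0.
by case=> // i _; exact: extXV.
Qed.

Section Coresolution.
Variables (S : nat -> A) (del : forall i, hom (S i) (S i.+1)) (d : nat).
Hypothesis deldel : forall i, del i.+1 \c del i = 0.
Hypothesis VS : forall i, V (S i).
Hypothesis S0 : forall i, (d < i)%N -> is_zero (S i).
Hypothesis liftW : forall i w (t : hom w (S i.+1)), W w ->
  del i.+1 \c t = 0 -> exists s, t = del i \c s.

(* Descending induction on [i]: embed [x] into some [w] in [W] with cokernel in
   [X]; a cycle on [x] extends to a cycle on [w], and that one lifts. *)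
Lemma liftX i x (t : hom x (S i.+1)) : X x ->
  del i.+1 \c t = 0 -> exists s, t = del i \c s.
Proof.
have [k] : exists k, (d <= i + k)%N by exists d; rewrite leq_addl.
elim: k i x t => [|k IHk] i x t dk Xx dt.
  exists 0; rewrite compm0; apply: zero_to; apply: S0.
  by rewrite ltnS (leq_trans dk) // addn0.
have [w [x' [f [g [Ww Xx' fg]]]]] := cogenW Xx.
have [t0 t0f] := extend_along t fg Xx' (VS _).
(* The defect [del i.+1 \c t0] kills [f], so it descends to a cycle [y] on [x']. By induction [y]
   comes from some [s'], and [t0 - s' \c g] is a cycle on [w] still restricting to [t]. *)
have [|y [yg _]] := fg.2.2 _ (del i.+1 \c t0); first by rewrite -compA -t0f.
have dy : del i.+2 \c y = 0.
  apply: (epi_eq0 (cokernel_epi fg.2)).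
  by rewrite -compA yg compA deldel comp0m.
have [s' ys'] := IHk i.+1 x' y (leq_trans dk (eq_leq (esym (addSnnS i k)))) Xx' dy.
have [|s ts] := @liftW i w (t0 - s' \c g) Ww.
  by rewrite compBr -yg ys' compA subrr.
exists (s \c f); rewrite compA -ts compBl -compA fg.1.1 compm0 subr0.
exact: t0f.
Qed.

(** With [Z i] the kernel of [del i]: a map into [Z i] is a coboundary in Hom(K, Z i). The case
    [i = 0] will concern [N]. *)
Definition cobounds i (K : chain A) n : hom (K n) (S i) -> Prop :=
  match n return hom (K n) (S i) -> Prop with
  | 0%N => fun u => u = 0
  | m.+1 => fun u => exists w : hom (K m) (S i), del i \c w = 0 /\ u = w \c dif K m
  end.

(** Descending induction on [i]. Exactness of Hom(K, S i) gives [u = w d]; then [del w] is a cocycle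
    into the next kernel, so by induction it is zero or [w' d] with [del w' = 0]. As [w'] lifts to
    some [s] by [liftX], [w - s d] is the map sought. *)
Lemma cocycle_cobounds i (K : chain A) n (u : hom (K n) (S i)) :
  acyclic K -> (forall j, X (K j)) ->
  del i \c u = 0 -> u \c dif K n = 0 -> cobounds u.
Proof.
move=> exK XK.
have [k] : exists k, (d < i + k)%N by exists d.+1; rewrite leq_addl.
elim: k i n u => [|k IHk] i [|n] u dk du ud /=;
  try by apply: (epi_eq0 _ ud); apply: lift_epi => T t; apply: (exK 0%N).
  exists 0; rewrite compm0 comp0m; split=> //; apply: zero_to; apply: S0.
  by rewrite addn0 in dk.
have [w uw] : exists w : hom (K n) (S i), u = w \c dif K n.
  by apply: acyclic_hom_exact => // m j _; apply: extXV.
have cw : cobounds (del i \c w).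
  apply: IHk; first by rewrite addSnnS.
  - by rewrite compA deldel comp0m.
  - by rewrite -compA -uw.
case: n u du ud w uw cw => [|n] u du ud w uw /=; first by exists w.
move=> [w' [dw' ww']]; have [s w's] := liftX (XK n) dw'.
exists (w - s \c dif K n); split.
  by rewrite compBr ww' w's compA subrr.
by rewrite compBl -compA difdif compm0 subr0.
Qed.

Lemma acyclic_hom_cores N (eta : hom N (S 0%N)) (K : chain A) n
    (u : hom (K n.+1) N) :
  is_kernel (del 0) eta -> acyclic K -> (forall j, X (K j)) ->
  u \c dif K n.+1 = 0 -> exists w : hom (K n) N, u = w \c dif K n.
Proof.
move=> keta exK XK ud.
have [||w [dw uw]] := cocycle_cobounds (u := eta \c u) exK XK.
- by rewrite compA keta.1 comp0m.
- by rewrite -compA ud compm0.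
have [w' [ew' _]] := keta.2 _ w dw; exists w'.
by apply: (kernel_mono keta); rewrite uw -ew' compA.
Qed.

End Coresolution.

Definition chain_of_res (C : set A) (M : A) (P : resolution C M) : chain A :=
  @Chain A (fun i => P i%:Z) (fun i => cd P i.+1%:Z i%:Z) (fun i => cdd _ _ _ _).

Lemma chain_of_res_resol C M (P : resolution C M) :
  resol (C := chain_of_res P) (res_aug P).
Proof.
have cP := res_coker P; split.
- exact: cokernel_epi cP.
- exact: cP.1.
- exact: cokernel_lex cP.
- move=> i; apply: (exact_atP _ _ _).1 (res_exact P _); rewrite //=; try lia.
Qed.

(* Exactness of Hom(cone f, N), spelled out on components. *)
Definition cone_hom_exact (C D : complex A) (f : cmap C D) (N : A) :=
  forall i j k l : int, j = i + 1 -> k = i - 1 -> l = j + 1 ->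
  forall (a : hom (C i) N) (b : hom (D j) N),
  b \c cd D l j = 0 -> b \c f j = a \c cd C j i ->
  exists (c : hom (D i) N) (w : hom (C k) N),
    b = c \c cd D j i /\ a = c \c f i + w \c cd C i k.

(** The cone of [f] is acyclic since both complexes resolve [M], and its terms, sums of a term of
    [Q] and one of [P], lie in [X]. The last premise is exactness of Hom(w, S) in negative
    degrees. *)
Theorem cone_hom_exact_cores M N (P : resolution W M) (Q : resolution X M)
    (f : cmap P Q) (S : coresolution V N) :
  lifts_id_res f -> bounded S ->
  (forall (i : nat) w (t : hom w (S (- i.+1%:Z))), W w ->
     cd S (- i.+1%:Z) (- i.+2%:Z) \c t = 0 ->
     exists s, t = cd S (- i%:Z) (- i.+1%:Z) \c s) ->
  cone_hom_exact f N.
Proof.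
move=> fid [b Sb] liftW.
pose g i : hom (chain_of_res P i) (chain_of_res Q i) := f i%:Z.
have gP : chmap g by move=> i; exact: cmapP.
have gq : qiso g := qiso_resol gP (chain_of_res_resol P) (chain_of_res_resol Q) fid.
pose K := cone gP; have exK : acyclic K := cone_acyclic gq.
have XK j : X (K j).
  case: j => [|j]; first exact: res_mem.
  by apply: Xsum; [exact: res_mem|apply: WX; exact: res_mem].
have S0 i : (`|b|%N < i)%N -> is_zero (S (- i%:Z)) by move=> bi; apply: Sb; lia.
have Khom n (u : hom (K n.+1) N) := @acyclic_hom_cores (fun i => S (- i%:Z))
  (fun i => cd S (- i%:Z) (- i.+1%:Z)) `|b|%N (fun i => cdd _ _ _ _)
  (fun i => cores_mem S _) S0 liftW N (cores_aug S) K n u (cores_ker S) exK XK.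
move=> [n|n] j k l jn kn lj a v vd va.
  have {}jn : j = n.+1%:Z by lia.
  have {}lj : l = n.+2%:Z by lia.
  subst j l; have [|w uw] := Khom n (copairm v a).
    rewrite /= copair_pair /copairm compDr !compA vd comp0m add0r va compmN.
    by rewrite compA subrr.
  have vw := congr1 (fun h => h \c in1) uw.
  have aw := congr1 (fun h => h \c in2) uw.
  case: n a v va vd kn w {uw} vw aw => [|n] a v va vd kn w /=.
    rewrite copair_in1 copair_in2 -!compA copair_in1 copair_in2 => vw aw.
    by exists w, 0; rewrite comp0m addr0.
  have {}kn : k = n%:Z by lia.
  subst k; rewrite copair_in1 copair_in2 -!compA !pair_comp copair_in1 copair_in2.
  rewrite (copairE w) !copair_pair !compNm -!compA bpr2_in1 bpr2_in2.
  rewrite !compm0 oppr0 !compm0 addr0 compm1 => vw aw.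
  (* The sign undoes that of the cone differential on the terms of [P]. *)
  exists (w \c in1), (- (w \c in2)); split; first by rewrite -compA.
  by rewrite aw !compmN compNm !compA.
(* Now [i < 0]. If [j = 0], then [v \c dif K 0 = 0] with [dif K 0] epi; if [j < 0], both maps start
   from zero objects. *)
have [j0|j0] := ltP j 0; last first.
  have n0 : n = 0%N by lia.
  have {}jn : j = 0 by lia.
  have {}lj : l = 1%:Z by lia.
  subst n j l; exists 0, 0; rewrite !comp0m addr0; split; last first.
    by apply: zero_from; apply: res_neg.
  have e0 : epi (dif K 0) by apply: lift_epi => T t; apply: (exK 0%N).
  apply: (epi_eq0 e0); rewrite /= /copairm compDr !compA vd va.
  rewrite (zero_from a) ?comp0m ?addr0 //.
  exact: res_neg.
exists 0, 0; rewrite !comp0m addr0.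
by split; apply: zero_from; apply: res_neg.
Qed.

End Core.

(** * The opposite category and reversal of complexes *)

Section OppositePreadditive.
Variable A : preadditive.

Fact op_compA (X Y Z T : A) (h : hom T Z) (g : hom Z Y) (f : hom Y X) :
  f \c g \c h = f \c (g \c h).
Proof. by rewrite compA. Qed.

Definition op_preadditive : preadditive :=
  @Preadditive A (fun X Y => hom Y X) (fun X => idm X)
    (fun X Y Z g f => f \c g) op_compA
    (fun X Y f => compm1 f) (fun X Y f => comp1m f)
    (fun X Y Z g g' f => compDr f g g') (fun X Y Z g f f' => compDl f f' g).

End OppositePreadditive.

Section Opposite.
Variable A : abelian.

Fact op_zero : exists Z : op_preadditive A, is_zero Z.
Proof. by have [Z Z0] := ab_zero A; exists Z => T; case: (Z0 T). Qed.

Fact op_biproduct (X Y : op_preadditive A) : exists B, is_biproduct X Y B.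
Proof.
by have [B [i [j [p [q [? ? ? ? ?]]]]]] := ab_biproduct (X : A) Y; exists B, p, q, i, j.
Qed.

Definition op : abelian :=
  @Abelian (op_preadditive A) op_zero op_biproduct
    (fun X Y f => @ab_cokernel A Y X f) (fun X Y f => @ab_kernel A Y X f)
    (fun X Y f => @ab_epi A Y X f) (fun X Y f => @ab_mono A Y X f).

(** Lifting up to epis must be turned into extending up to monos. [g] and [t] factor through the
    cokernel of [f] as [g'] and [t']; exactness makes [g'] mono, and the pushout of [g'] and [t']
    provides the extension. *)
Lemma lex_op (X Y Z : A) (f : hom X Y) (g : hom Y Z) :
  g \c f = 0 -> lex f g -> @lex op Z Y X g f.
Proof.
move=> gf fg T t tf; have [Q [c cc]] := ab_cokernel f.
have [g' [g'c _]] := cc.2 _ g gf; have [t' [t'c _]] := cc.2 _ t tf.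
have mg' : mono g'.
  apply: mono0 => U u g'u.
  have [U1 [e1 [s1 [ee1 es1]]]] := epi_lift u (cokernel_epi cc).
  have [|U2 [e2 [s2 [ee2 es2]]]] := fg _ s1.
    by rewrite -g'c -compA es1 compA g'u comp0m.
  apply: (epi_eq0 ee1); apply: (epi_eq0 ee2).
  by rewrite -es1 -compA -es2 compA cc.1 comp0m.
have [T' [e [s [ee es]]]] := @epi_lift op Z Q T g' t' mg'.
exists T', e, s; split=> //.
have {}es : @comp A _ _ _ s g' = @comp A _ _ _ e t' := es.
change (@comp A _ _ _ s g = @comp A _ _ _ e t).
by rewrite -g'c -t'c !compA es.
Qed.

Section Reindex.
Variable nu : int -> int.
Hypothesis nuS : forall i j, (nu j = nu i + 1) <-> (i = j + 1).
Variable C : complex A.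

Fact rev_shape i j : i != j + 1 -> cd C (nu j) (nu i) = 0.
Proof.
by move=> ij; apply: cd_shape; apply: contraNneq ij => /nuS/eqP.
Qed.

(** The hypothesis on [nu] forces [nu i = nu 0 - i]. Resolutions are reversed by [- i], extensions
    by [n.+1 - i]. *)
Definition rev_cx : complex op :=
  @Complex op (fun i => C (nu i)) (fun i j => cd C (nu j) (nu i)) rev_shape
    (fun i j k => cdd C (nu k) (nu j) (nu i)).

Lemma rev_lexact : lexact C -> lexact rev_cx.
Proof. by move=> exC p n m /nuS pn /nuS nm; apply: lex_op; [exact: cdd|exact: exC]. Qed.

Lemma rev_exact_at i j : nu j = i -> exact_at C i -> exact_at rev_cx j.
Proof.
move=> <- exi; apply/(exact_atP _ erefl erefl).
apply: lex_op; first exact: cdd.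
apply: (exact_atP _ _ _).1 exi; first by apply/nuS; rewrite subrK.
by apply/(addIr 1); rewrite subrK; apply/esym/nuS.
Qed.

End Reindex.

Definition rev_cmap nu nuS (C D : complex A) (f : cmap C D) :
    cmap (@rev_cx nu nuS D) (@rev_cx nu nuS C) :=
  @CMap op (rev_cx nuS D) (rev_cx nuS C) (fun i => f (nu i))
    (fun i j => esym (cmapP f (nu j) (nu i))).

End Opposite.

Section Cast.
Variables (A : abelian).
Implicit Type C : complex A.

(** Reversal sends degree [n.+1] to 0 only up to a provable equality, so the ends of a reversed
    extension need these identifications. *)
Definition cast C i j (e : i = j) : hom (C i) (C j) :=
  eq_rect i (fun k => hom (C i) (C k)) (idm _) j e.

Lemma cast1 C i (e : i = i) : cast C e = idm _.
Proof. by rewrite /cast (eq_axiomK e). Qed.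

Lemma cast_comp C i j k (e : i = j) (e' : j = k) (e'' : i = k) :
  cast C e' \c cast C e = cast C e''.
Proof. by subst; rewrite !cast1 comp1m. Qed.

Lemma cast_iso C i j (e : i = j) : is_iso (cast C e).
Proof. by exists (cast C (esym e)); rewrite !cast_comp !cast1. Qed.

Lemma cast_cmap C D (f : cmap C D) i j (e : i = j) :
  f j \c cast C e = cast D e \c f i.
Proof. by subst; rewrite !cast1 comp1m compm1. Qed.

Lemma cast_cd C i j i' j' (e : i = i') (e' : j = j') :
  cast C e' \c cd C i j = cd C i' j' \c cast C e.
Proof. by subst; rewrite !cast1 comp1m compm1. Qed.

End Cast.

Lemma iso_comp (A : abelian) (X Y Z : A) (g : hom Y Z) (f : hom X Y) :
  is_iso g -> is_iso f -> is_iso (g \c f).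
Proof.
move=> [g' [g'g gg']] [f' [f'f ff']]; exists (f' \c g'); split.
  by rewrite compA -(compA f') g'g compm1.
by rewrite compA -(compA g) ff' compm1.
Qed.

Lemma op_iso (A : abelian) (X Y : A) (f : hom X Y) :
  is_iso f -> @is_iso (op A) Y X f.
Proof. by move=> [g [gf fg]]; exists g. Qed.

(** * Yoneda Ext in the opposite category *)

Section RevExtension.
Variables (n : nat).

Definition flip (i : int) := n.+1%:Z - i.

Fact flipS i j : (flip j = flip i + 1) <-> (i = j + 1).
Proof. by rewrite /flip; split; lia. Qed.

Fact flip0 : n.+1%:Z = flip 0. Proof. by rewrite /flip; lia. Qed.
Fact flipn : flip n.+1%:Z = 0. Proof. by rewrite /flip; lia. Qed.
Fact flipK i : i = flip (flip i). Proof. by rewrite /flip; lia. Qed.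

Fact rev_supp (A : abelian) (X Y : A) (E : extension n X Y) (i : int) :
  i < 0 \/ n.+1%:Z < i -> is_zero (rev_cx flipS E i).
Proof.
move=> hi; suff E0 : is_zero (E (flip i)) by move=> T; case: (E0 T).
by apply: ext_supp; move: hi; rewrite /flip; lia.
Qed.

Definition rev_ext (A : abelian) (X Y : A) (E : extension n X Y) :
    @extension (op A) n Y X :=
  @Extension (op A) n Y X (rev_cx flipS E) (@rev_supp A X Y E)
    (fun i => rev_exact_at flipS erefl (ext_exact E _))
    (cast E flip0 \c ext_bot E)
    (op_iso (iso_comp (cast_iso E flip0) (ext_bot_iso E)))
    (ext_top E \c cast E flipn)
    (op_iso (iso_comp (ext_top_iso E) (cast_iso E flipn))).

Lemma rev_ext_step (A : abelian) (X Y : A) (E F : extension n X Y) :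
  ext_step E F -> ext_step (rev_ext F) (rev_ext E).
Proof.
move=> [f [ft fb]]; exists (rev_cmap flipS f); split=> /=.
  transitivity (f (flip 0) \c (cast E flip0 \c ext_bot E)); first by [].
  by rewrite compA cast_cmap -compA fb.
transitivity (ext_top F \c cast F flipn \c f (flip n.+1%:Z)); first by [].
by rewrite -compA -cast_cmap compA ft.
Qed.

Lemma rev_ext_equiv (A : abelian) (X Y : A) (E F : extension n X Y) :
  ext_equiv E F -> ext_equiv (rev_ext E) (rev_ext F).
Proof.
elim=> [E1 E2 st|E1|E1 E2 _ h|E1 E2 E3 _ h1 _ h2].
- by apply: rst_sym; apply: rst_step; exact: rev_ext_step.
- exact: rst_refl.
- exact: rst_sym.
- exact: rst_trans h2.
Qed.

Definition unop2_cx (A : abelian) (C : complex (op (op A))) : complex A :=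
  @Complex A (cobj C) (cd C) (@cd_shape _ C) (cdd C).

Definition unop2 (A : abelian) (X Y : A) (E : @extension (op (op A)) n X Y) :
    extension n X Y :=
  @Extension A n X Y (unop2_cx E) (@ext_supp _ _ _ _ E) (ext_exact E)
    (ext_top E) (ext_top_iso E) (ext_bot E) (ext_bot_iso E).

Lemma cast_rev (A : abelian) (C : complex (op A)) i j (e : i = j)
    (e' : flip j = flip i) :
  cast (unop2_cx (rev_cx flipS C)) e = cast C e' :> @hom A _ _.
Proof. by subst j; rewrite !cast1. Qed.

(** Reversing twice replaces degree [i] by [flip (flip i)], so the casts along [flipK] form a
    morphism of extensions. *)
Lemma rev_rev_step (A : abelian) (X Y : A) (E : @extension (op A) n Y X) :
  ext_step E (rev_ext (unop2 (rev_ext E))).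
Proof.
pose f : cmap E (rev_ext (unop2 (rev_ext E))) :=
  @CMap (op A) E (rev_ext (unop2 (rev_ext E))) (fun i => cast E (flipK i))
    (fun i j => cast_cd _ _ _).
exists f; split.
  rewrite /= (cast_rev E flip0 (congr1 flip (esym flip0))).
  change (ext_top E \c cast E flipn \c cast E (congr1 flip (esym flip0))
          \c cast E (flipK 0) = ext_top E).
  rewrite -!compA (cast_comp E (flipK 0) _ (esym flipn)).
  by rewrite (cast_comp E _ _ erefl) cast1 compm1.
rewrite /= (cast_rev E flipn (congr1 flip (esym flipn))).
change (cast E (flipK n.+1%:Z) \c ext_bot E =
        cast E (congr1 flip (esym flipn)) \c (cast E flip0 \c ext_bot E)).
by rewrite compA (cast_comp E _ _ (flipK n.+1%:Z)).
Qed.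

(** Two extensions over [op A] are reversed, linked over [A], and reversed back; each is one step
    away from its double reversal. *)
Lemma Ext_zero_op (A : abelian) (X Y : A) :
  Ext_zero n X Y -> @Ext_zero (op A) n Y X.
Proof.
move=> ext0 E F.
have h := rev_ext_equiv (ext0 (unop2 (rev_ext E)) (unop2 (rev_ext F))).
apply: rst_trans (rst_step _ _ _ _ (rev_rev_step E)) _.
apply: rst_trans h (rst_sym _ _ _ _ (rst_step _ _ _ _ (rev_rev_step F))).
Qed.

End RevExtension.

(** * Homology of complexes of abelian groups *)

Section HomologyLemmas.

Lemma homology_piP (K : abcomplex) n p (z : cycle K n) : p = n + 1 ->
  \pi_(homology K n)%qT z = 0 <-> exists y : K p, abd K p n y = val z.
Proof.
move=> ->; have -> : (\pi_(homology K n)%qT z = 0) <-> z \in @boundary_pred K n.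
  rewrite -[X in X \in _]subr0 Quotient.idealrBE -(raddf0 \pi_(homology K n)%qT).
  by split=> /eqP.
by rewrite unfold_in; split=> /asboolP.
Qed.

Lemma homology_zeroP (K : abcomplex) n p q : p = n + 1 -> q = n - 1 ->
  homology_zero K n <->
  forall z, abd K n q z = 0 -> exists y : K p, abd K p n y = z.
Proof.
move=> pn ->; split=> [K0 z /eqP zc|h x].
  by have /(homology_piP (Cycle zc) pn) := K0 (\pi%qT (Cycle zc)).
rewrite -[x]reprK; apply/(homology_piP _ pn); apply: h.
exact/eqP/cycle_valP.
Qed.

Lemma homology_map_bijective (K L : abcomplex) (f : abmap K L) n p q :
  p = n + 1 -> q = n - 1 ->
  (forall z : L n, abd L n q z = 0 ->
     exists (x : K n) (y : L p), abd K n q x = 0 /\ z = f n x + abd L p n y) ->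
  (forall (x : K n) (y : L p), abd K n q x = 0 -> f n x = abd L p n y ->
     exists x' : K p, x = abd K p n x') ->
  bijective (homology_map f (n := n)).
Proof.
move=> pn qn surj inj; subst q.
have f_inj : injective (homology_map f (n := n)).
  move=> x1 x2 x12; have h : homology_map f (x1 - x2) = 0.
    by rewrite raddfB /= x12 subrr.
  apply/eqP; rewrite -subr_eq0; apply/eqP; move: (x1 - x2) h => x.
  rewrite -[x]reprK homology_map_pi => /(homology_piP _ pn)[y /esym].
  move=> /inj[|x' xx']; first exact/eqP/cycle_valP.
  by apply/(homology_piP _ pn); exists x'.
have f_surj z : exists x, homology_map f (n := n) x = z.
  have [x [y [/eqP xc zE]]] := surj _ (eqP (cycle_valP (repr z))).
  exists (\pi%qT (Cycle xc)); rewrite homology_map_pi.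
  apply/eqP; rewrite -subr_eq0 -[z]reprK -raddfB; apply/eqP.
  by apply/(homology_piP _ pn); exists (- y); rewrite raddfN /= zE opprD addNKr.
exists (fun z => projT1 (cid (f_surj z))) => z.
  by apply: f_inj; case: cid.
by case: cid.
Qed.

End HomologyLemmas.

(** * Comparison maps and mapping cones *)

Section Theta.
Variables (A : abelian) (W X : set A).

(** Cone cocycles [(a, 0)] give surjectivity; cocycles [(y, b)], with [y] bounding the image of [b],
    give injectivity. *)
Lemma theta_l_bijective M N (P : resolution W M) (Q : resolution X M)
    (f : cmap P Q) n :
  cone_hom_exact f N -> bijective (theta_l f N n).
Proof.
move=> ex; apply: (homology_map_bijective (p := - n + 1) (q := - n - 1)) => //=.
  move=> a; rewrite /precomp => ac.
  have [|||c [w [cd0 ->]]] :=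
      ex (- - n) (- (- n - 1)) (- (- n + 1)) _ _ _ erefl a 0 (comp0m _ _); try lia.
    by rewrite comp0m ac.
  by exists c, w; rewrite -cd0.
move=> b y; rewrite /precomp => bc bf.
have [||c [w [-> _]]] :=
    ex (- (- n + 1)) (- - n) _ (- (- n - 1)) _ erefl _ y b bc bf; try lia.
by exists c.
Qed.

(** Exactness of Hom(M, cone f), spelled out on components up to signs. *)
Definition cocone_hom_exact (C D : complex A) (f : cmap C D) (M : A) :=
  forall i j k l : int, j = i - 1 -> k = i + 1 -> l = j - 1 ->
  forall (a : hom M (D i)) (b : hom M (C j)),
  cd C j l \c b = 0 -> f j \c b = cd D i j \c a ->
  exists (c : hom M (C i)) (w : hom M (D k)),
    b = cd C i j \c c /\ a = f i \c c + cd D k i \c w.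

Lemma theta_r_bijective M N (P : coresolution X N) (Q : coresolution W N)
    (f : cmap P Q) n :
  cocone_hom_exact f M -> bijective (theta_r f M n).
Proof.
move=> ex; apply: (homology_map_bijective (p := - n + 1) (q := - n - 1)) => //=.
  move=> a; rewrite /postcomp => ac.
  have [|c [w [cd0 ->]]] :=
      ex (- n) (- n - 1) (- n + 1) _ erefl erefl erefl a 0 (compm0 _ _).
    by rewrite compm0 ac.
  by exists c, w; rewrite -cd0.
move=> b y; rewrite /postcomp => bc bf.
have [||c [w [-> _]]] := ex (- n + 1) (- n) _ (- n - 1) _ erefl _ y b bc bf; try lia.
by exists c.
Qed.

End Theta.

(** * Duality of resolutions and coresolutions; properness of bounded ones *)

Section Duality.
Variable A : abelian.

Fact oppS (i j : int) : (- j = - i + 1) <-> (i = j + 1).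
Proof. by split; lia. Qed.

Lemma op_is_zero (Z : A) : is_zero Z -> @is_zero (op A) Z.
Proof. by move=> Z0 T; case: (Z0 T). Qed.

Definition op_res (C : set A) (N : A) (P : @coresolution A C N) : @resolution (op A) C N.
Proof.
refine (@Resolution (op A) C N (rev_cx oppS P) (cores_aug P)
  (fun i => cores_mem P _) _ _ _).
- by move=> i i0; apply: op_is_zero; apply: cores_pos; rewrite oppr_gt0.
- move=> i i0; apply: (rev_exact_at oppS erefl); apply: cores_exact.
  by rewrite oppr_lt0.
- exact: (cores_ker P).
Defined.

Definition op_cores (C : set A) (M : A) (P : @resolution A C M) :
    @coresolution (op A) C M.
Proof.
refine (@Coresolution (op A) C M (rev_cx oppS P) (res_aug P)
  (fun i => res_mem P _) _ _ _).
- by move=> i i0; apply: op_is_zero; apply: res_neg; rewrite oppr_lt0.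
- move=> i i0; apply: (rev_exact_at oppS erefl); apply: res_exact.
  by rewrite oppr_gt0.
- exact: (res_coker P).
Defined.

Lemma cone_cocone_hom_exact (C D : complex A) (f : cmap C D) (M : A) :
  @cone_hom_exact (op A) _ _ (rev_cmap oppS f) M -> cocone_hom_exact f M.
Proof.
move=> ex i j k l; rewrite -[i]opprK -[j]opprK -[k]opprK -[l]opprK.
move: (- i) (- j) (- k) (- l) => {}i {}j {}k {}l ji ki lj a b cb fb.
have [|||c [w [bc ac]]] := ex i j k l _ _ _ a b cb fb; try lia.
by exists c, w.
Qed.

Lemma lexact_hom_op (C : complex A) (V : A) (d : nat) (p n q : int)
    (u : hom V (C n)) :
  lexact C -> (forall i : int, d%:Z < i -> is_zero (C i)) ->
  n = p + 1 -> q = n + 1 ->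
  (forall (m : int) i, q < m -> Ext_zero i.+1 V (C m)) ->
  cd C n p \c u = 0 -> exists w : hom V (C q), u = cd C q n \c w.
Proof.
move: u; rewrite -[n]opprK -[p]opprK -[q]opprK.
move: (- n) (- p) (- q) => {}n {}p {}q u exC C0 np qn ext0 du.
apply: (@lexact_hom (op A) (rev_cx oppS C) V d p n q u _ _ _ _ _ du); try lia.
- exact: rev_lexact.
- by move=> i i0; apply: op_is_zero; apply: C0; lia.
- by move=> m i mq; apply: Ext_zero_op; apply: ext0; lia.
Qed.

Lemma coaug_lexact (C : set A) N (P : coresolution C N) : lexact (coaugmented P).
Proof.
have kP := cores_ker P.
move=> p [[|[|n]]|n] m pn nm T t.
- have {}pn : p = 1 by lia. have {}nm : m = -1 by lia. subst p m => /= dt.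
  have [s [es _]] := kP.2 _ t dt.
  by exists T, (idm T), s; split; [exact: epi_id|rewrite compm1].
- have {}nm : m = 0 by lia. subst m => /= dt.
  by rewrite (mono_eq0 (kernel_mono kP) dt); exact: lift0.
- move=> _; rewrite (zero_to t); first exact: lift0.
  exact: cores_pos.
have {}nm : m = Negz n.+1 by lia. subst m => /= dt.
case: n pn t dt => [|n] pn t dt.
  have {}pn : p = 0 by lia. subst p.
  by apply: (exact_atP _ _ _).1 (cores_exact P _) _ _ dt; lia.
have {}pn : p = Negz n by lia. subst p.
by apply: (exact_atP _ _ _).1 (cores_exact P _) _ _ dt; lia.
Qed.

Lemma aug_lexact (C : set A) M (P : resolution C M) : lexact (augmented P).
Proof.
have cP := res_coker P.
move=> p [[|n]|[|n]] m pn nm T t.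
- have {}pn : p = 1 by lia. have {}nm : m = -1 by lia. subst p m => /= dt.
  exact: (cokernel_lex cP).
- have {}pn : p = n.+2 by lia. have {}nm : m = n by lia. subst p m => /= dt.
  by apply: (exact_atP _ _ _).1 (res_exact P _) _ _ dt; lia.
- have {}pn : p = 0 by lia. subst p => _.
  by apply: epi_lift; exact: cokernel_epi cP.
- move=> _; rewrite (zero_to t); first exact: lift0.
  exact: res_neg.
Qed.

(** Dimension shifting on the coaugmented complex: [N] sits in degree 1, whereas Ext is taken from
    terms of negative degree, which lie in [V]. *)
Lemma bounded_proper_cores (V : set A) N (P : coresolution V N) :
  perp V V -> bounded P -> proper_cores P.
Proof.
move=> VV [b Pb] V' VV' n.
apply/(homology_zeroP _ erefl erefl) => u; rewrite /= /precomp => ud.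
have [n2|n2] := ltP 1 (- n).
  have P0 : is_zero (coaugmented P (- n)).
    by move: n2; case: (- n) => [[|[|m]]|m] // _; exact: cores_pos.
  by exists 0; rewrite /= /precomp comp0m (zero_from u P0).
have [w ->] : exists w : hom (coaugmented P (- (n + 1))) V',
    u = w \c cd (coaugmented P) (- n) (- (n + 1)); last by exists w.
apply: (@lexact_hom A (coaugmented P) V' (absz b) (- (n - 1)) (- n) (- (n + 1)) u
  (@coaug_lexact _ _ P) _ _ _ _ ud); try lia.
  case=> [m|m] m0 //=; first by lia.
  by apply: Pb; lia.
move=> [[|[|m]]|m] i mn /=; try lia.
by apply: VV => //; exact: cores_mem.
Qed.

Lemma bounded_proper_res (W : set A) M (P : resolution W M) :
  perp W W -> bounded P -> proper_res P.
Proof.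
move=> WW [b Pb] W' WW' n.
apply/(homology_zeroP _ erefl erefl) => u; rewrite /= /postcomp => du.
have [n2|n2] := ltP n (-1).
  have P0 : is_zero (augmented P n).
    by case: n n2 {u du} => [m|[|m]] // _; exact: res_neg.
  by exists 0; rewrite /= /postcomp compm0 (zero_to u P0).
have [w ->] : exists w : hom W' (augmented P (n + 1)),
    u = cd (augmented P) (n + 1) n \c w; last by exists w.
apply: (@lexact_hom_op (augmented P) W' (absz b) (n - 1) n _ u
  (@aug_lexact _ _ P) _ _ _ _ du); try lia.
  by case=> [m|m] m0 //; apply: Pb; lia.
move=> [m|m] i mn /=; last by lia.
by apply: WW => //; exact: res_mem.
Qed.

End Duality.

Theorem proposition4p14 (A : abelian) (W X V Y : set A)
    (subW : subcategory W) (subX : subcategory X)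
    (subV : subcategory V) (subY : subcategory Y)
    (WX : W `<=` X) (VY : V `<=` Y)
    (cogenW : cogenerator W X) (genV : generator V Y) (M N : A) :
  (* (a) *)
  (perp (X `|` V) V ->
   (forall (n : int) (W' U : A), 1 <= n -> W W' -> cores_hat V U ->
      relExt_r_zero V W' U n) ->
   (res_tilde X `&` res_tilde W) M -> cores_hat V N ->
   forall (P : resolution W M) (Q : resolution X M) (f : cmap P Q),
     proper_res P -> proper_res Q -> lifts_id_res f ->
     forall n : int, bijective (theta_l f N n)) /\
  (* (b) *)
  (perp W (W `|` Y) ->
   (forall (n : int) (U V' : A), 1 <= n -> res_hat W U -> V V' ->
      relExt_l_zero W U V' n) ->
   res_hat W M -> (cores_tilde Y `&` cores_tilde V) N ->
   forall (P : coresolution Y N) (Q : coresolution V N) (f : cmap P Q),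
     proper_cores P -> proper_cores Q -> lifts_id_cores f ->
     forall n : int, bijective (theta_r f M n)).
Proof.
split=> [XVV ext0 _ NV P Q f _ _ fid n|WWY ext0 MW _ P Q f _ _ fid n].
  have [S Sb] := NV.
  apply: theta_l_bijective.
  apply: (cone_hom_exact_cores WX cogenW (V := V) _ _ (S := S)) => //.
  - move=> x y Xx Xy; case: subX => _ sumX _.
    by apply: sumX Xx Xy _; exact: dsum_biproduct.
  - by move=> i x v Xx Vv; apply: XVV => //; left.
  move=> i w t Ww dt.
  have VV : perp V V by move=> j x y j0 Vx Vy; apply: XVV => //; right.
  (* The relative Ext hypothesis bears on proper coresolutions, which is why [S] is shown to be
     proper. *)
  have h := ext0 i.+1%:Z w N isT Ww NV S (bounded_proper_cores VV Sb).
  have [||s st] :=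
      (@homology_zeroP (homr w S) (- i.+1%:Z) (- i%:Z) (- i.+2%:Z) _ _).1 h t dt; try lia.
  by exists s; rewrite -st.
have [S Sb] := MW.
apply: theta_r_bijective; apply: cone_cocone_hom_exact.
(* In [op A] the roles of [W], [X], [V] pass to [V], [Y], [W], those of [M] and [N] are exchanged,
   and the bounded resolution [S] of [M] becomes a coresolution. *)
apply: (@cone_hom_exact_cores (op A) V Y W VY _ _ _ N M (op_res Q) (op_res P)
  (rev_cmap oppS f) (op_cores S)).
- move=> y /genV[v [y' [g [h [Vv Yy' [kg ch]]]]]].
  by exists v, y', h, g; split.
- move=> x y Xx Xy; case: subY => _ + _; apply; [exact: Xx|exact: Xy|].
  have [i [j [p [q [? ? ? ? ?]]]]] := @dsum_biproduct (op A) x y.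
  by exists p, q, i, j.
- by move=> i x v Yx Wv; apply: Ext_zero_op; apply: WWY => //; right.
- exact: fid.
- by have [b Sb'] := Sb; exists b => i bi; apply: op_is_zero; apply: Sb'; rewrite normrN.
move=> i w t Vw dt.
have WW : perp W W by move=> j x y j0 Wx Wy; apply: WWY => //; left.
have h := ext0 i.+1%:Z M w isT MW Vw S (bounded_proper_res WW Sb).
have [||s st] :=
    (@homology_zeroP (@homl A w S) (- i.+1%:Z) (- i%:Z) (- i.+2%:Z) _ _).1 h t dt; try lia.
by exists s; rewrite -st.
Qed.
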